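(* Let $E\subset\mathbb{C}$ be a compact set with $\mathrm{cap}(E)>0$ whose Green function satisfies the H\''older condition: there are constants $C(E)>0$ and $0<s\le1$ such that $$g_E(z,\infty)\le C(E)\,(d_E(z))^s,\qquad z\in\Omega_E.$$ For each $n\ge2$, let $Z_n=\{z_{k,n}\}_{k=1}^n\subset E$ be either a set $\mathcal{F}_n$ of $n$-th Fekete points of $E$, or the set $\{\xi_k\}_{k=0}^{n-1}$ of the first $n$ points of a sequence $\{\xi_k\}_{k=0}^\infty$ of Leja points of $E$. Let $\Omega_n=\{z\in\Omega_E:\ g_E(z,\infty)>1/n\}$ and $P_n(z)=\prod_{k=1}^n(z-z_{k,n})$. Then there are constants $C_2,C_3>0$, independent of $n$, of $z$, and of the choice of the sets $Z_n$, such that for all $n\ge2$ $$\left|\frac1n\log|P_n(z)|+V_E-g_E(z,\infty)\right|\le C_2\,\frac{\log n}{\sqrt n},\qquad z\in\overline{\Omega}_n,$$ $$\log\|P_n\|_E+nV_E\le C_2\sqrt n\,\log n+1,$$ and $$-C_3\,\frac{\log n}{\sqrt n}\le\hat I[\tau(Z_n)]-V_E.$$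
   Context: For a Borel measure $\mu$ with compact support in $\mathbb{C}$, its energy is $I[\mu]=\iint\log\frac{1}{|z-t|}\,d\mu(t)\,d\mu(z)$. For compact $E\subset\mathbb{C}$, let $\mathcal{M}(E)$ be the set of all Borel probability measures supported on $E$; Robin's constant is $V_E=\inf_{\mu\in\mathcal{M}(E)}I[\mu]$ and the capacity is $\mathrm{cap}(E)=e^{-V_E}$. If $\mathrm{cap}(E)>0$, the infimum is attained by a unique measure $\mu_E\in\mathcal{M}(E)$, the equilibrium measure of $E$. $\Omega_E$ is the unbounded connected component of $\overline{\mathbb{C}}\setminus E$, and $g_E(z,\infty)$ is the Green function of $\Omega_E$ with pole at $\infty$, extended to all of $\mathbb{C}$ by $g_E(z,\infty)=V_E-\int\log\frac{1}{|z-t|}\,d\mu_E(t)$, $z\in\mathbb{C}$. The distance to $E$ is $d_E(z)=\min_{t\in E}|z-t|$ (the H\''older condition concerns finite points $z\in\Omega_E$). For a set of $n\ge2$ points $Z_n=\{z_{k,n}\}_{k=1}^n$, $V(Z_n)=\prod_{1\le j<k\le n}(z_{j,n}-z_{k,n})$ is the Vandermonde determinant, $\tau(Z_n)=\frac1n\sum_{k=1}^n\delta_{z_{k,n}}$ is the counting measure, and the discrete energy is $$\hat I[\tau(Z_n)]=-\log|V(Z_n)|^{\frac{2}{n(n-1)}}=\frac{2}{n(n-1)}\sum_{1\le j<k\le n}\log\frac{1}{|z_{j,n}-z_{k,n}|}.$$ $\|P\|_E=\sup_{z\in E}|P(z)|$. A set $\mathcal{F}_n\subset E$ of $n$ points is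 called a set of $n$-th Fekete points of $E$ if $|V(\mathcal{F}_n)|=\max_{Z_n\subset E}|V(Z_n)|$, the maximum being over all $n$-point sets in $E$. A sequence $\{\xi_k\}_{k=0}^\infty\subset E$ is a sequence of Leja points of $E$ if $\xi_0\in E$ is arbitrary and, for each $n\ge0$, $\xi_{n+1}\in E$ satisfies $\prod_{k=0}^n|\xi_{n+1}-\xi_k|=\max_{z\in E}\prod_{k=0}^n|z-\xi_k|$. The function $\frac1n\log|P_n(z)|+V_E-g_E(z,\infty)$ is given its limiting value $0$ at $z=\infty$. The constants $C_2,C_3$ may depend on $E$. *)

(* Defs.v *)
From HB Require Import structures.
From mathcomp Require Import all_boot all_order all_algebra.
From mathcomp Require Import all_classical all_reals all_analysis.
From mathcomp Require Export complex.

Set Implicit Arguments.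
Unset Strict Implicit.
Unset Printing Implicit Defensive.

Import Order.TTheory GRing.Theory Num.Theory.
Import numFieldTopology.Exports.

Local Open Scope classical_set_scope.
Local Open Scope ring_scope.

(* The plane is R[i] with R : realType. Its topology sits on the alias
   (R[i])^o, and Normc.normc is the R-valued modulus. *)
Notation plane R := ((R[i])^o) (only parsing).
Notation modulus z := (Normc.normc z).

Notation sphere R := (one_point_compactification (plane R)) (only parsing).

Definition borelC (R : realType) :=
  g_sigma_algebraType (@open (plane R)).

Section potential_theory.
Context {R : realType}.
Implicit Types (E : set (plane R)) (mu : probability (borelC R) R).

(* lne r%:E = -oo for r <= 0, hence log (1/|z - t|) = +oo at t = z. *)
Definition log_kernel (z t : R[i]) : \bar R := (- lne (modulus (z - t))%:E)%E.

Definition potential mu (z : R[i]) : \bar R :=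
  (\int[mu]_t log_kernel z t)%E.

Definition energy mu : \bar R := (\int[mu]_z potential mu z)%E.

(* For compact E, a Borel measure is supported on E iff its complement is
   null. *)
Definition prob_on E : set (probability (borelC R) R) :=
  [set mu | mu (~` E : set (borelC R)) = 0%E].

Definition robin E : \bar R := ereal_inf [set energy mu | mu in prob_on E].

Definition capacity E : \bar R := expeR (- robin E)%E.

Definition is_equilibrium_measure E mu : Prop :=
  prob_on E mu /\ energy mu = robin E.

(* [None] is the point at infinity. *)
Definition Omega E : set (sphere R) :=
  connected_component (~` (Some @` E) : set (sphere R)) None.

(* mu is meant to be the equilibrium measure of E. *)
Definition green E mu (z : R[i]) : \bar R := (robin E - potential mu z)%E.

Definition green_sphere E mu (z : sphere R) : \bar R :=
  if z is Some w then green E mu w else +oo%E.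

Definition dist_to E (z : R[i]) : R := inf [set modulus (z - t) | t in E].

Definition green_holder E mu : Prop :=
  exists C s : R, [/\ 0 < C, 0 < s <= 1 &
    forall z : R[i], Omega E (Some z) ->
      (green E mu z <= (C * dist_to E z `^ s)%:E)%E].

Definition Omega_n E mu (n : nat) : set (sphere R) :=
  [set z | Omega E z /\ ((n%:R^-1)%:E < green_sphere E mu z)%E].

(* A set of n points is given by an enumeration 'I_n -> R[i]. *)
Definition vandermonde n (Z : 'I_n -> R[i]) : R[i] :=
  \prod_(j < n) \prod_(k < n | (j < k)%N) (Z j - Z k).

Definition discrete_energy n (Z : 'I_n -> R[i]) : \bar R :=
  (- lne ((modulus (vandermonde Z)) `^ (2 / (n%:R * (n%:R - 1))))%:E)%E.

Definition node_poly n (Z : 'I_n -> R[i]) : {poly R[i]} :=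
  \prod_(k < n) ('X - (Z k)%:P).

Definition sup_norm E (P : {poly R[i]}) : \bar R :=
  ereal_sup [set (modulus P.[z])%:E | z in E].

Definition is_fekete E n (Z : 'I_n -> R[i]) : Prop :=
  [/\ injective Z, (forall k, E (Z k)) &
    forall W : 'I_n -> R[i], injective W -> (forall k, E (W k)) ->
      modulus (vandermonde W) <= modulus (vandermonde Z)].

Definition is_leja E (xi : nat -> R[i]) : Prop :=
  (forall k, E (xi k)) /\
  forall (n : nat) (z : R[i]), E z ->
    \prod_(k < n.+1) modulus (z - xi k) <=
    \prod_(k < n.+1) modulus (xi n.+1 - xi k).

Definition fekete_or_leja E n (Z : 'I_n -> R[i]) : Prop :=
  is_fekete E Z \/ exists2 xi, is_leja E xi & forall k : 'I_n, Z k = xi k.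

(* n^-1 log |P(z)| + V_E - g_E(z, oo), with its limiting value 0 at oo. *)
Definition deviation E mu (n : nat) (P : {poly R[i]}) (z : sphere R) : \bar R :=
  if z is Some w then
    ((n%:R^-1)%:E * lne (modulus P.[w])%:E + robin E - green E mu w)%E
  else 0%E.

End potential_theory.

(* Main.v *)
(* The logarithmic kernel is replaced by l_e(z) = - 1/2 ln(|z|^2 + e^2), which is
   conditionally positive definite: through stereographic projection
   |z - w|^2 + e^2 = a(z) a(w) (1 - K(z, w)) with K of finite rank and |K| < 1, and
   - ln (1 - K) = sum_k K^k / k.  Let r be given by C r^s = 1/n and e = r / n.  The
   Hoelder condition bounds the regularized potential U_e of the equilibrium measure
   below by V - 2/n on the points of the outer domain at distance r from E, and the
   minimum principle for U_e, which is superharmonic on the whole plane, carries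
   this bound over to E.
   Averaging over the equilibrium measure one point at a time produces n points of E
   with |Vandermonde| >= e^{- n(n-1)/2 V}; a Vandermonde determinant of points of E
   is at most n! times the one of the Fekete or Leja points (for Leja points, expand
   det (P_i(w_j)) where P_i vanishes at the first i points).  Hence the regularized
   energy D of (counting measure) - mu is O(log n / n).  D >= 0 is the lower bound of
   the discrete energy, and Cauchy-Schwarz against delta_z - delta_w with |w| ~ n
   gives |U_tau(z) - U_mu(z)| = O(sqrt (D log n)) = O(log n / sqrt n).  The bound of
   the sup norm follows on the points at distance r from E, hence on E by the minimum
   principle for the potential of the counting measure. *)

Require Import Defs.
From mathcomp Require Import all_boot all_order all_algebra.
From mathcomp Require Import all_classical all_reals all_analysis.
From mathcomp Require Import perm measurable_realfun.
From mathcomp Require Import zify ring lra.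
Import Order.TTheory GRing.Theory Num.Theory.
Import numFieldTopology.Exports numFieldNormedType.Exports.

Set Implicit Arguments.
Unset Strict Implicit.
Unset Printing Implicit Defensive.

Local Open Scope classical_set_scope.
Local Open Scope ring_scope.

(** * The topology of the plane *)

Section plane_topology.
Context {R : realType}.
Implicit Types (z w x y : R[i]) (E K : set (plane R)).

Lemma modulus_ge0 z : 0 <= modulus z.
Proof. by case: z => a b; exact: sqrtr_ge0. Qed.

Lemma sqr_modulus z : modulus z ^+ 2 = complex.Re z ^+ 2 + complex.Im z ^+ 2.
Proof. by case: z => a b /=; rewrite sqr_sqrtr ?addr_ge0 ?sqr_ge0. Qed.

Lemma modulus_subC z w : modulus (z - w) = modulus (w - z).
Proof. by rewrite -opprB normcN. Qed.

Lemma modulus_dist z w x : modulus (z - x) <= modulus (z - w) + modulus (w - x).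
Proof. by apply: le_trans (le_normcD _ _); rewrite addrA subrK. Qed.

Lemma le_modulus_dist z w : `|modulus z - modulus w| <= modulus (z - w).
Proof.
have h u v : modulus u - modulus v <= modulus (u - v).
  by rewrite lerBlDr; apply: le_trans (le_normcD _ _); rewrite subrK.
rewrite ler_norml h andbT lerNl opprB [leRHS]modulus_subC; exact: h.
Qed.

Lemma normr_Re_le z : `|complex.Re z| <= modulus z.
Proof.
by rewrite -ler_sqr ?nnegrE ?modulus_ge0// real_normK ?num_real// sqr_modulus lerDl sqr_ge0.
Qed.

Lemma normr_Im_le z : `|complex.Im z| <= modulus z.
Proof.
by rewrite -ler_sqr ?nnegrE ?modulus_ge0// real_normK ?num_real// sqr_modulus lerDr sqr_ge0.
Qed.

Lemma modulus_real (a : R) : modulus a%:C%C = `|a|.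
Proof. by rewrite /= expr0n/= addr0 sqrtr_sqr. Qed.

Lemma nbhs_planeP (x : plane R) (A : set (plane R)) :
  nbhs x A <-> exists2 e : R, 0 < e & forall y, modulus (x - y) < e -> A y.
Proof.
split.
- case=> e /= e0 eA; exists (complex.Re e).
    by move: e0; rewrite ltcE /= => /andP[].
  move=> y xy; apply: eA; rewrite /ball_ /= ltcE /=.
  by move: e0; rewrite ltcE /= => /andP[-> _] /=.
- case=> e e0 eA; exists e%:C%C; first by rewrite /= ltcE /= eqxx.
  by move=> y; rewrite /ball_ /= ltcE /= eqxx /=; exact: eA.
Qed.

Lemma lipschitz_continuous_plane (f : plane R -> R) (c : R) :
  (forall x y, `|f x - f y| <= c * modulus (x - y)) -> continuous f.
Proof.
move=> fc x A /nbhs_ballP[e /= e0 eA].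
apply/nbhs_planeP; exists (e / (`|c| + 1)).
  by rewrite divr_gt0// ltr_wpDl.
move=> y xy; apply: eA; move: xy; rewrite /ball /=; rewrite ltr_pdivlMr ?ltr_wpDl// => xy.
apply: le_lt_trans (fc _ _) _.
apply: le_lt_trans xy; rewrite mulrC ler_wpM2l ?modulus_ge0//.
by rewrite (le_trans (ler_norm _))// lerDl.
Qed.

Lemma continuous_Re : continuous (@complex.Re R : plane R -> R).
Proof.
apply: (@lipschitz_continuous_plane _ 1) => x y; rewrite mul1r.
by apply: le_trans (normr_Re_le _); case: x; case: y.
Qed.

Lemma continuous_Im : continuous (@complex.Im R : plane R -> R).
Proof.
apply: (@lipschitz_continuous_plane _ 1) => x y; rewrite mul1r.
by apply: le_trans (normr_Im_le _); case: x; case: y.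
Qed.

Lemma continuous_dist (z : R[i]) : continuous ((fun t => modulus (z - t)) : plane R -> R).
Proof.
apply: (@lipschitz_continuous_plane _ 1) => x y; rewrite mul1r.
by apply: le_trans (le_modulus_dist _ _) _; rewrite opprB addrC addrA subrK modulus_subC.
Qed.


Lemma bounded_closed_compact_plane (K : set (plane R)) (M : R) :
  closed K -> (forall z, K z -> modulus z <= M) -> compact K.
Proof.
move=> cK KM.
pose f (p : R * R) : plane R := (p.1 +i* p.2)%C.
have cf : continuous f.
  move=> p A /nbhs_planeP[e e0 eA]; exists (ball p.1 (e / 2), ball p.2 (e / 2)).
    by split; apply: nbhsx_ballx; rewrite divr_gt0.
  move=> [a b] [/= pa pb]; apply: eA; rewrite -(@ltr_pXn2r _ 2) ?nnegrE ?modulus_ge0 ?ltW//.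
  rewrite sqr_modulus /=; move: pa pb; rewrite /ball /= => pa pb.
  have {}pa : (p.1 - a) ^+ 2 <= (e / 2) ^+ 2.
    by rewrite -[leLHS]real_normK ?num_real// lerXn2r ?nnegrE ?normr_ge0 ?ltW// divr_gt0.
  have {}pb : (p.2 - b) ^+ 2 <= (e / 2) ^+ 2.
    by rewrite -[leLHS]real_normK ?num_real// lerXn2r ?nnegrE ?normr_ge0 ?ltW// divr_gt0.
  by apply: le_lt_trans (lerD pa pb) _; nra.
have csq : compact (f @` (`[- M, M] `*` `[- M, M])).
  apply: continuous_compact; first exact: continuous_subspaceT.
  by apply: compact_setX; exact: segment_compact.
apply: (subclosed_compact cK csq) => z Kz.
exists (complex.Re z, complex.Im z); last by rewrite /f /=; case: z {Kz}.
split; rewrite /= in_itv /= -ler_norml (le_trans _ (KM _ Kz))//.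
  exact: normr_Re_le.
exact: normr_Im_le.
Qed.

Lemma compact_plane_bounded (K : set (plane R)) : compact K ->
  exists2 M : R, 0 < M & forall z, K z -> modulus z <= M.
Proof.
move=> cK; have [K0|K0] := pselect (K !=set0); last first.
  by exists 1 => // z Kz; case: K0; exists z.
have ct : {within K, continuous ((fun t => modulus (0 - t)) : plane R -> R)}.
  exact/continuous_subspaceT/continuous_dist.
have [c _ cmax] := compact_EVT_max K0 cK ct.
exists (modulus (0 - c) + 1); first by rewrite ltr_wpDl ?modulus_ge0.
move=> z Kz; rewrite -[z]subr0 modulus_subC.
by rewrite (le_trans (cmax _ _)) ?inE// lerDl.
Qed.

Lemma hausdorff_plane : hausdorff_space (plane R).
Proof.
move=> x y xy; apply/eqP; apply/negP => /negP nxy.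
have d0 : 0 < modulus (x - y).
  rewrite lt0r modulus_ge0 andbT; apply: contra nxy => /eqP /(@Normc.eq0_normc R)/eqP.
  by rewrite subr_eq0.
have nb (z : plane R) : nbhs z (fun t : plane R => modulus (z - t) < modulus (x - y) / 2).
  by apply/nbhs_planeP; exists (modulus (x - y) / 2) => //; rewrite divr_gt0.
have [z [xz yz]] := xy _ _ (nb x) (nb y).
have := modulus_dist x z y; rewrite [X in _ <= _ + X]modulus_subC; lra.
Qed.

Lemma compact_closed_plane (K : set (plane R)) : compact K -> closed K.
Proof. by move=> cK; exact: (compact_closed hausdorff_plane). Qed.

End plane_topology.

(** * The regularized logarithmic kernel *)

Section kernel.
Context {R : realType}.
Implicit Types (z w x y : R[i]) (e d : R).

Lemma ln_series_bound (N : nat) (q x : R) : 0 <= q < 1 -> `|x| <= q ->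
  `| ln (1 - x) + \sum_(k < N) x ^+ k.+1 / k.+1%:R | <= q ^+ N / (1 - q).
Proof.
move=> /andP[q0 q1] xq.
pose p : {poly R} := \sum_(k < N) (k.+1%:R^-1 *: 'X^(k.+1)).
have pE t : p.[t] = \sum_(k < N) t ^+ k.+1 / k.+1%:R.
  rewrite horner_sum; apply: eq_bigr => k _.
  by rewrite hornerZ hornerXn mulrC.
have p'E t : t < 1 -> (p^`()).[t] = (1 - t ^+ N) / (1 - t).
  move=> t1; rewrite /p raddf_sum horner_sum /=.
  under eq_bigr => k _.
    rewrite derivZ derivXn hornerZ hornerMn hornerXn /=
      mulrnAr -mulrnAl -(mulr_natr (k.+1%:R^-1))
      mulVf ?mul1r ?pnatr_eq0//.
  over.
  apply/(canRL (mulfK _)); first by rewrite subr_eq0 gt_eqF.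
  by rewrite -[1 - t]opprB mulrC mulNr -subrX1 opprB.
pose f (t : R) := ln (1 - t) + p.[t].
have df (t : R) : t < 1 -> is_derive t 1 f (- (t ^+ N / (1 - t))).
  move=> t1.
  have d1 : is_derive t 1 (fun t : R => ln (1 - t)) (- (1 - t)^-1).
    have t1' : 0 < 1 - t by rewrite subr_gt0.
    have := is_derive1_ln t1' => dl.
    have ds : is_derive t 1 (fun t : R => 1 - t) (- 1 : R).
      have := @is_deriveB R R R (cst 1) id t 1 0 1 _ _.
      by rewrite sub0r; apply.
    have := @is_derive1_comp R (@ln R) (fun t : R => 1 - t) t _ _ dl ds.
    by rewrite mulrN1.
  have := @is_deriveD R R R _ _ t 1 _ _ d1 (is_derive_poly p t).
  rewrite p'E//.
  suff -> : - (1 - t)^-1 + (1 - t ^+ N) / (1 - t) = - (t ^+ N / (1 - t)) by [].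
  by rewrite mulrBl mul1r addrA addNr sub0r.
have bound t : `|t| <= q -> `|- (t ^+ N / (1 - t))| <= q ^+ N / (1 - q).
  move=> tq; have t1 : 1 - q <= 1 - t by rewrite lerD2l lerN2 (le_trans (ler_norm _)).
  have q1' : 0 < 1 - q by rewrite subr_gt0.
  rewrite normrN normrM normfV normrX (ger0_norm (le_trans (ltW q1') t1)).
  rewrite ler_pM ?exprn_ge0 ?invr_ge0 ?(le_trans (ltW q1') t1)//.
    by rewrite lerXn2r// ?nnegrE.
  by rewrite lef_pV2 ?posrE// (lt_le_trans q1').
have mvt a b : a <= b -> `|a| <= q -> `|b| <= q ->
    `|f b - f a| <= q ^+ N / (1 - q) * (b - a).
  move=> ab; rewrite !ler_norml => /andP[qa aq] /andP[qb bq].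
  have lt1 t : t <= b -> t < 1 by move=> tb; rewrite (le_lt_trans tb)// (le_lt_trans bq).
  have drv t : t \in `]a, b[ -> is_derive t 1 f (- (t ^+ N / (1 - t))).
    by move=> /itvP tab; apply: df; apply: lt1; rewrite tab.
  have cf : {within `[a, b], continuous f}.
    apply/continuous_in_subspaceT => t; rewrite inE /= => /itvP tab.
    apply: differentiable_continuous; apply/derivable1_diffP.
    by have [] := df t (lt1 t _); rewrite ?tab.
  have [c cab ->] := MVT_segment ab drv cf.
  rewrite -ler_norml normrM [`|b - a|]ger0_norm ?subr_ge0//.
  rewrite ler_wpM2r ?subr_ge0// bound// ler_norml.
  by rewrite (le_trans qa) ?(itvP cab)//= (le_trans _ bq) ?(itvP cab).
have f0 : f 0 = 0.
  rewrite /f pE subr0 ln1 add0r big1// => k _.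
  by rewrite expr0n /= mul0r.
rewrite -pE -/(f x).
have B0 : 0 <= q ^+ N / (1 - q).
  by apply: divr_ge0; [exact: exprn_ge0|rewrite subr_ge0 ltW].
have n0 : `|0 : R| <= q by rewrite normr0.
have x1 : `|x| <= 1 by rewrite (le_trans xq)// ltW.
have [x0|x0] := leP 0 x.
  have := mvt 0 x x0 n0 xq; rewrite f0 !subr0 => /le_trans; apply.
  by rewrite ler_piMr// (le_trans (ler_norm _)).
have := mvt x 0 (ltW x0) xq n0; rewrite f0 sub0r normrN => /le_trans; apply.
by rewrite ler_piMr// sub0r (le_trans _ x1)// -normrN ler_norm.
Qed.

Definition log_kernel_reg e z : R := - ln (modulus z ^+ 2 + e ^+ 2) / 2.

Lemma log_kernel_regN e z : log_kernel_reg e (- z) = log_kernel_reg e z.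
Proof. by rewrite /log_kernel_reg normcN. Qed.

Lemma log_kernel_reg_subC e z w : log_kernel_reg e (z - w) = log_kernel_reg e (w - z).
Proof. by rewrite -log_kernel_regN opprB. Qed.

Lemma reg_arg_gt0 e z : 0 < e -> 0 < modulus z ^+ 2 + e ^+ 2.
Proof. by move=> e0; rewrite ltr_wpDl ?sqr_ge0// exprn_gt0. Qed.

Lemma log_kernel_reg_sub_le e u z w : 0 < e -> 0 <= u ->
  modulus (z - w) <= u * Num.max e (modulus z) ->
  log_kernel_reg e z - log_kernel_reg e w <= u.
Proof.
move=> e0 u0; set m := Num.max _ _; set d := modulus (z - w) => dm.
have z0 := modulus_ge0 z; have w0 := modulus_ge0 w; have d0 := modulus_ge0 (z - w).
have wz : modulus w <= modulus z + d.
  by have := le_normcD z (w - z); rewrite addrC subrK modulus_subC.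
have em : e <= m by rewrite le_max lexx.
have zm : modulus z <= m by rewrite le_max lexx orbT.
have m2 : m ^+ 2 <= modulus z ^+ 2 + e ^+ 2.
  have [h|/ltW h] := leP e (modulus z); [rewrite /m (max_r h)|rewrite /m (max_l h)].
    by rewrite lerDl sqr_ge0.
  by rewrite lerDr sqr_ge0.
have le1 : modulus w ^+ 2 + e ^+ 2 <= (modulus z ^+ 2 + e ^+ 2) * (1 + u) ^+ 2.
  have h1 : modulus w ^+ 2 <= (modulus z + u * m) ^+ 2.
    have h : modulus w <= modulus z + u * m by apply: le_trans wz _; rewrite lerD2l.
    by rewrite lerXn2r ?nnegrE// (le_trans w0).
  have h2 : u * (modulus z * m) <= u * m ^+ 2.
    by rewrite ler_wpM2l// expr2 ler_wpM2r// (le_trans z0).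
  have h3 : u * m ^+ 2 <= u * (modulus z ^+ 2 + e ^+ 2) by rewrite ler_wpM2l.
  have h4 : u ^+ 2 * m ^+ 2 <= u ^+ 2 * (modulus z ^+ 2 + e ^+ 2) by rewrite ler_wpM2l ?sqr_ge0.
  lra.
have u1 : 0 < 1 + u by rewrite ltr_wpDr.
have : ln (modulus w ^+ 2 + e ^+ 2) <= ln (modulus z ^+ 2 + e ^+ 2) + u * 2.
  have h1 : ln (modulus w ^+ 2 + e ^+ 2) <= ln ((modulus z ^+ 2 + e ^+ 2) * (1 + u) ^+ 2).
    by rewrite ler_ln ?posrE ?mulr_gt0 ?exprn_gt0 ?reg_arg_gt0.
  apply: le_trans h1 _; rewrite lnM ?posrE ?exprn_gt0 ?reg_arg_gt0// lerD2l lnXn//.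
  by rewrite mulr_natr lerMn2r /= le_ln1Dx// (lt_le_trans (ltrN10 _)).
rewrite /log_kernel_reg; lra.
Qed.

Lemma log_kernel_reg_lipschitz e z w : 0 < e ->
  `|log_kernel_reg e z - log_kernel_reg e w| <= e^-1 * modulus (z - w).
Proof.
move=> e0.
have key x y : log_kernel_reg e x - log_kernel_reg e y <= e^-1 * modulus (x - y).
  have ei : 0 <= e^-1 by rewrite invr_ge0 ltW.
  apply: log_kernel_reg_sub_le => //; first by rewrite mulr_ge0 ?modulus_ge0.
  rewrite mulrAC ler_peMl ?modulus_ge0//.
  by rewrite mulrC ler_pdivlMr// mul1r le_max lexx.
rewrite ler_norml key andbT lerNl opprB modulus_subC; exact: key.
Qed.

Lemma log_kernel_reg_far e z w : 0 < e -> 0 < modulus z ->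
  log_kernel_reg e z - log_kernel_reg e w <= modulus (z - w) / modulus z.
Proof.
move=> e0 z0; apply: log_kernel_reg_sub_le => //.
  by rewrite divr_ge0 ?modulus_ge0.
rewrite mulrAC -mulrA ler_peMr ?modulus_ge0//.
by rewrite ler_pdivlMr// mul1r le_max lexx orbT.
Qed.

Lemma log_kernel_reg_le e z : 0 < e -> 0 < modulus z ->
  log_kernel_reg e z <= - ln (modulus z).
Proof.
move=> e0 z0; rewrite /log_kernel_reg.
suff : ln (modulus z) * 2 <= ln (modulus z ^+ 2 + e ^+ 2) by lra.
by rewrite mulr_natr -lnXn// ler_ln ?posrE ?exprn_gt0 ?reg_arg_gt0// lerDl sqr_ge0.
Qed.

Lemma log_kernel_reg_ge e d z : 0 < e -> 0 < d -> d <= modulus z ->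
  - ln (modulus z) <= log_kernel_reg e z + (e / d) ^+ 2 / 2.
Proof.
move=> e0 d0 dz; have z0 : 0 < modulus z by exact: lt_le_trans dz.
rewrite /log_kernel_reg.
suff : ln (modulus z ^+ 2 + e ^+ 2) <= ln (modulus z) * 2 + (e / d) ^+ 2 by lra.
have p0 : 0 <= (e / d) ^+ 2 by rewrite sqr_ge0.
apply: (@le_trans _ _ (ln (modulus z ^+ 2 * (1 + (e / d) ^+ 2)))).
  rewrite ler_ln ?posrE ?mulr_gt0 ?exprn_gt0 ?reg_arg_gt0 ?ltr_wpDr//.
  rewrite mulrDr mulr1 lerD2l expr_div_n mulrCA ler_peMr ?sqr_ge0//.
  by rewrite ler_pdivlMr ?exprn_gt0// mul1r lerXn2r ?nnegrE ?(ltW d0) ?(ltW z0).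
rewrite lnM ?posrE ?exprn_gt0 ?ltr_wpDr// lnXn// mulr_natr lerD2l le_ln1Dx//.
by rewrite (lt_le_trans (ltrN10 _)).
Qed.

Lemma log_kernel_reg_diag e : 0 < e -> log_kernel_reg e 0 = - ln e.
Proof.
move=> e0; rewrite /log_kernel_reg Normc.normc0 expr0n add0r lnXn//.
by rewrite -[ln e *+ 2]mulr_natr mulNr mulfK ?pnatr_eq0.
Qed.

End kernel.

(** * Conditional positive definiteness *)

Section functionals.
Context {R : realType}.
Implicit Types (f g : plane R -> R) (S : set (plane R)) (L : (plane R -> R) -> R).

Lemma continuous_planeD f g :
  continuous f -> continuous g -> continuous (fun z => f z + g z : R).
Proof. by move=> cf cg x; exact: (continuousD (cf x) (cg x)). Qed.

Lemma continuous_planeM f g :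
  continuous f -> continuous g -> continuous (fun z => f z * g z : R).
Proof. by move=> cf cg x; exact: (continuousM (cf x) (cg x)). Qed.

Lemma continuous_plane_cst (a : R) : continuous (fun _ : plane R => a).
Proof. exact: cst_continuous. Qed.

Lemma continuous_planeX f n : continuous f -> continuous (fun z => f z ^+ n : R).
Proof.
move=> cf; elim: n => [|n IH]; first exact: continuous_plane_cst.
by under eq_fun do rewrite exprS; exact: continuous_planeM.
Qed.

Definition linear_on_continuous L := forall (a : R) f g, continuous f -> continuous g ->
  L (fun z => a * f z + g z) = a * L f + L g.

Definition dominated S (A : R) L := forall f (B : R), continuous f ->
  (forall z, S z -> `|f z| <= B) -> `|L f| <= A * B.

Section linear_functional.
Variables (L : (plane R -> R) -> R) (linL : linear_on_continuous L).

Lemma functionalD f g : continuous f -> continuous g ->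
  L (fun z => f z + g z) = L f + L g.
Proof.
move=> cf cg; have := linL 1 cf cg; rewrite mul1r => <-.
by congr L; apply/funext => z; rewrite mul1r.
Qed.

Lemma functional0 : L (fun=> 0) = 0.
Proof.
have c0 := @continuous_plane_cst 0.
have := functionalD c0 c0.
under eq_fun do rewrite addr0.
by move=> /eqP; rewrite -subr_eq subrr => /eqP.
Qed.

Lemma functionalZ a f : continuous f -> L (fun z => a * f z) = a * L f.
Proof.
move=> cf; have := linL a cf (@continuous_plane_cst 0); rewrite functional0 addr0 => <-.
by congr L; apply/funext => z; rewrite addr0.
Qed.

Lemma functionalB f g : continuous f -> continuous g ->
  L (fun z => f z - g z) = L f - L g.
Proof.
move=> cf cg; have := linL (-1) cg cf; rewrite mulN1r addrC => <-.
by congr L; apply/funext => z; rewrite mulN1r addrC.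
Qed.

Lemma functional_cst a : L (fun=> a) = a * L (fun=> 1).
Proof.
rewrite -functionalZ; last exact: continuous_plane_cst.
by congr L; apply/funext => z; rewrite mulr1.
Qed.

Lemma functional_sum (I : Type) (r : seq I) (F : I -> plane R -> R) :
  (forall i, continuous (F i)) ->
  L (fun z => \sum_(i <- r) F i z) = \sum_(i <- r) L (F i).
Proof.
move=> cF; suff [] : continuous (fun z => \sum_(i <- r) F i z) /\
  L (fun z => \sum_(i <- r) F i z) = \sum_(i <- r) L (F i) by [].
elim: r => [|i r [cr IH]].
  rewrite big_nil; under eq_fun do rewrite big_nil.
  by split; [exact: continuous_plane_cst|exact: functional0].
rewrite big_cons; under eq_fun do rewrite big_cons.
by split; [exact: continuous_planeD|rewrite functionalD// IH].
Qed.

Lemma functional_lipschitz S A (G : R[i] -> R[i] -> R) (c : R) : 0 <= A ->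
  dominated S A L -> (forall z, continuous (G z : plane R -> R)) ->
  (forall z z' w, S w -> `|G z w - G z' w| <= c * modulus (z - z')) ->
  forall z z', `|L (G z) - L (G z')| <= (A * c) * modulus (z - z').
Proof.
move=> A0 domL cG lipG z z'; rewrite -functionalB// -mulrA; apply: domL.
  have cN : continuous (fun w : plane R => (-1) * G z' w : R).
    by apply: continuous_planeM => //; exact: continuous_plane_cst.
  have := continuous_planeD (cG z) cN.
  by under eq_fun do rewrite mulN1r.
by move=> w Sw; exact: lipG.
Qed.

End linear_functional.
Lemma functional_dist (L : (plane R -> R) -> R) (S : set (plane R)) (f : plane R -> R) (a d : R) :
  linear_on_continuous L -> dominated S 1 L -> L (fun=> 1) = 1 -> continuous f ->
  (forall z, S z -> `|f z - a| <= d) -> `|L f - a| <= d.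
Proof.
move=> linL domL L1 cf fd.
have -> : L f - a = L (fun z => f z - a).
  by rewrite (functionalB linL cf (@continuous_plane_cst a)) (functional_cst linL a) L1 mulr1.
rewrite -[d]mul1r; apply: domL => //.
exact: (continuous_planeD cf (@continuous_plane_cst (- a))).
Qed.

End functionals.

Section positive_definite.
Context {R : realType}.
Implicit Types (z w : R[i]) (f g : plane R -> R).
Variables (e : R) (e0 : 0 < e) (e1 : e <= 1).

(* Writing b z = |z|^2 + e^2/2, one has
   |z - w|^2 + e^2 = (1 + b z) (1 + b w) (1 - K z w) / 2, where K is the inner
   product of the stereographic features (1 - b, 2x, 2y) / (1 + b). *)
Definition stereo_weight z : R := 1 + (modulus z ^+ 2 + e ^+ 2 / 2).
Definition stereo_height z : R := (2 - stereo_weight z) / stereo_weight z.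
Definition stereo_x z : R := 2 * complex.Re z / stereo_weight z.
Definition stereo_y z : R := 2 * complex.Im z / stereo_weight z.
Definition stereo_kernel z w : R :=
  stereo_height z * stereo_height w + stereo_x z * stereo_x w + stereo_y z * stereo_y w.

Lemma stereo_weight_gt0 z : 0 < stereo_weight z.
Proof. by rewrite /stereo_weight ltr_wpDr// addr_ge0 ?divr_ge0 ?sqr_ge0. Qed.

Lemma continuous_modulus_sqr : continuous (fun z : plane R => modulus z ^+ 2 : R).
Proof.
apply: continuous_planeX => z.
by have := @continuous_dist R 0 z; under eq_fun do rewrite sub0r normcN.
Qed.

Lemma continuous_stereo_weight : continuous (stereo_weight : plane R -> R).
Proof.
apply: continuous_planeD; first exact: continuous_plane_cst.
by apply: continuous_planeD; [exact: continuous_modulus_sqr|exact: continuous_plane_cst].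
Qed.

Lemma continuous_stereo_weightV : continuous (fun z : plane R => (stereo_weight z)^-1 : R).
Proof.
move=> z; apply: continuousV; first by rewrite gt_eqF// stereo_weight_gt0.
exact: continuous_stereo_weight.
Qed.

Lemma continuous_ln_stereo_weight : continuous (fun z : plane R => ln (stereo_weight z) : R).
Proof.
move=> z; apply: (@continuous_comp (plane R) R R stereo_weight (@ln R)).
  exact: continuous_stereo_weight.
exact/continuous_ln/stereo_weight_gt0.
Qed.

Lemma continuous_stereo_height : continuous (stereo_height : plane R -> R).
Proof.
apply: continuous_planeM; last exact: continuous_stereo_weightV.
under eq_fun do rewrite -mulN1r.
apply: continuous_planeD; first exact: continuous_plane_cst.
by apply: continuous_planeM; [exact: continuous_plane_cst|exact: continuous_stereo_weight].
Qed.

Lemma continuous_stereo_x : continuous (stereo_x : plane R -> R).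
Proof.
apply: continuous_planeM; last exact: continuous_stereo_weightV.
by apply: continuous_planeM; [exact: continuous_plane_cst|exact: continuous_Re].
Qed.

Lemma continuous_stereo_y : continuous (stereo_y : plane R -> R).
Proof.
apply: continuous_planeM; last exact: continuous_stereo_weightV.
by apply: continuous_planeM; [exact: continuous_plane_cst|exact: continuous_Im].
Qed.

Lemma continuous_stereo_kernel z : continuous (stereo_kernel z : plane R -> R).
Proof.
apply: continuous_planeD; first apply: continuous_planeD.
- by apply: continuous_planeM; [exact: continuous_plane_cst|exact: continuous_stereo_height].
- by apply: continuous_planeM; [exact: continuous_plane_cst|exact: continuous_stereo_x].
- by apply: continuous_planeM; [exact: continuous_plane_cst|exact: continuous_stereo_y].
Qed.

Lemma stereo_kernelE z w : stereo_kernel z w * (stereo_weight z * stereo_weight w) =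
  (2 - stereo_weight z) * (2 - stereo_weight w) +
  4 * (complex.Re z * complex.Re w + complex.Im z * complex.Im w).
Proof.
rewrite /stereo_kernel /stereo_height /stereo_x /stereo_y.
have := stereo_weight_gt0 z; have := stereo_weight_gt0 w.
by move=> /lt0r_neq0 w0 /lt0r_neq0 z0; field; rewrite w0 z0.
Qed.

Lemma stereo_kernel_dist z w :
  (1 - stereo_kernel z w) * (stereo_weight z * stereo_weight w) =
  2 * (modulus (z - w) ^+ 2 + e ^+ 2).
Proof.
rewrite mulrBl stereo_kernelE /stereo_weight !sqr_modulus.
by case: z => a b; case: w => c d /=; field.
Qed.

Lemma stereo_kernel_lt1 z w : 0 < 1 - stereo_kernel z w.
Proof.
have p : 0 < stereo_weight z * stereo_weight w by rewrite mulr_gt0 ?stereo_weight_gt0.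
by rewrite -(pmulr_lgt0 _ p) stereo_kernel_dist mulr_gt0// reg_arg_gt0.
Qed.

Lemma stereo_kernel_bound z w :
  `|stereo_kernel z w| <= 1 - e ^+ 4 / (2 * (stereo_weight z * stereo_weight w)).
Proof.
have p : 0 < stereo_weight z * stereo_weight w by rewrite mulr_gt0 ?stereo_weight_gt0.
have s1 : e ^+ 2 <= 1 by rewrite expr_le1// ltW.
have s0 : 0 <= e ^+ 2 by rewrite sqr_ge0.
have e4 : e ^+ 4 = e ^+ 2 * e ^+ 2 by rewrite -exprD.
have hp : stereo_kernel z w * (stereo_weight z * stereo_weight w) <=
    stereo_weight z * stereo_weight w - e ^+ 4 / 2.
  have := stereo_kernel_dist z w; rewrite mulrBl mul1r => h.
  have m0 : 0 <= modulus (z - w) ^+ 2 by rewrite sqr_ge0.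
  have : e ^+ 2 * e ^+ 2 <= e ^+ 2 by rewrite ler_piMr.
  rewrite e4; lra.
have hm : - (stereo_weight z * stereo_weight w - e ^+ 4 / 2) <=
    stereo_kernel z w * (stereo_weight z * stereo_weight w).
  rewrite stereo_kernelE -subr_ge0 /stereo_weight !sqr_modulus e4.
  move: (e ^+ 2) s0 => s s0; case: z {p hp} => a b; case: w => c d /=.
  have -> : (2 - (1 + (a ^+ 2 + b ^+ 2 + s / 2))) * (2 - (1 + (c ^+ 2 + d ^+ 2 + s / 2))) +
     4 * (a * c + b * d) -
     - ((1 + (a ^+ 2 + b ^+ 2 + s / 2)) * (1 + (c ^+ 2 + d ^+ 2 + s / 2)) - s * s / 2) =
     2 * (1 + (a * c + b * d)) ^+ 2 + 2 * (a * d - b * c) ^+ 2 +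
     s * (a ^+ 2 + b ^+ 2 + c ^+ 2 + d ^+ 2) by field.
  apply: addr_ge0; last by rewrite mulr_ge0// !addr_ge0 ?sqr_ge0.
  by apply: addr_ge0; apply: mulr_ge0 => //; exact: sqr_ge0.
have -> : 1 - e ^+ 4 / (2 * (stereo_weight z * stereo_weight w)) =
    (stereo_weight z * stereo_weight w - e ^+ 4 / 2) / (stereo_weight z * stereo_weight w).
  by field; rewrite !gt_eqF ?stereo_weight_gt0.
rewrite ler_norml ler_pdivlMr// hp andbT -mulNr ler_pdivrMr//.
Qed.

Lemma log_kernel_regE z w : 2 * log_kernel_reg e (z - w) =
  - ln (1 - stereo_kernel z w) + (ln 2 - ln (stereo_weight z) - ln (stereo_weight w)).
Proof.
have k0 := stereo_kernel_lt1 z w.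
have := congr1 (@ln R) (stereo_kernel_dist z w).
rewrite !lnM ?posrE ?mulr_gt0 ?stereo_weight_gt0 ?reg_arg_gt0//.
rewrite /log_kernel_reg; lra.
Qed.

Lemma continuous_log_kernel_reg z :
  continuous ((fun w => log_kernel_reg e (z - w)) : plane R -> R).
Proof.
apply: (@lipschitz_continuous_plane _ _ e^-1) => x y.
apply: le_trans (log_kernel_reg_lipschitz _ _ e0) _.
by have -> : z - x - (z - y) = y - x; [ring|rewrite modulus_subC].
Qed.

Variables (S : set (plane R)) (rho A : R) (L : (plane R -> R) -> R).
Hypotheses (A0 : 0 <= A) (linL : linear_on_continuous L) (domL : dominated S A L).
Hypothesis S_bounded : forall z, S z -> modulus z <= rho.

Lemma continuous_functional_log_kernel_reg :
  continuous (fun z : plane R => L (fun w => log_kernel_reg e (z - w)) : R).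
Proof.
apply: (@lipschitz_continuous_plane _ _ (A * e^-1)).
apply: (functional_lipschitz linL A0 domL).
  exact: continuous_log_kernel_reg.
move=> z z' w _; apply: le_trans (log_kernel_reg_lipschitz _ _ e0) _.
by rewrite opprB addrA subrK.
Qed.

Lemma stereo_kernelX_posdef k g : continuous g ->
  continuous (fun z : plane R => L (fun w => g w * stereo_kernel z w ^+ k) : R) /\
  0 <= L (fun z => g z * L (fun w => g w * stereo_kernel z w ^+ k)).
Proof.
elim: k g => [|k IH] g cg.
  have E z : L (fun w => g w * stereo_kernel z w ^+ 0) = L g.
    by congr L; apply/funext => w; rewrite expr0 mulr1.
  split; first by under eq_fun do rewrite E; exact: continuous_plane_cst.
  under eq_fun do rewrite E mulrC.
  by rewrite (functionalZ linL)// -expr2 sqr_ge0.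
have ch := continuous_planeM cg continuous_stereo_height.
have cx := continuous_planeM cg continuous_stereo_x.
have cy := continuous_planeM cg continuous_stereo_y.
have [Ih Ih0] := IH _ ch; have [Ix Ix0] := IH _ cx; have [Iy Iy0] := IH _ cy.
have cK z g' : continuous g' -> continuous (fun w : plane R => g' w * stereo_kernel z w ^+ k : R).
  by move=> cg'; apply: continuous_planeM => //; exact/continuous_planeX/continuous_stereo_kernel.
have cZ z a g' : continuous g' ->
    continuous (fun w : plane R => a * (g' w * stereo_kernel z w ^+ k) : R).
  by move=> cg'; apply: continuous_planeM; [exact: continuous_plane_cst|exact: cK].
have E z : L (fun w => g w * stereo_kernel z w ^+ k.+1) =
    stereo_height z * L (fun w => g w * stereo_height w * stereo_kernel z w ^+ k) +
    stereo_x z * L (fun w => g w * stereo_x w * stereo_kernel z w ^+ k) +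
    stereo_y z * L (fun w => g w * stereo_y w * stereo_kernel z w ^+ k).
  rewrite -!(functionalZ linL)//; do 1?exact: cK.
  rewrite -!(functionalD linL)//; do 1?[exact: cZ|by apply: continuous_planeD; exact: cZ].
  congr L; apply/funext => w; rewrite exprS /stereo_kernel; ring.
have c1 := continuous_planeM continuous_stereo_height Ih.
have c2 := continuous_planeM continuous_stereo_x Ix.
have c3 := continuous_planeM continuous_stereo_y Iy.
split.
  by under eq_fun do rewrite E; apply: continuous_planeD => //; exact: continuous_planeD.
have gE z : g z * L (fun w => g w * stereo_kernel z w ^+ k.+1) =
    g z * stereo_height z * L (fun w => g w * stereo_height w * stereo_kernel z w ^+ k) +
    g z * stereo_x z * L (fun w => g w * stereo_x w * stereo_kernel z w ^+ k) +
    g z * stereo_y z * L (fun w => g w * stereo_y w * stereo_kernel z w ^+ k).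
  by rewrite E; ring.
under eq_fun do rewrite gE.
have d1 := continuous_planeM ch Ih.
have d2 := continuous_planeM cx Ix.
have d3 := continuous_planeM cy Iy.
rewrite (functionalD linL (continuous_planeD d1 d2) d3) (functionalD linL d1 d2).
by rewrite !addr_ge0.
Qed.

Lemma log_kernel_reg_posdef : L (fun=> 1) = 0 ->
  0 <= L (fun z => L (fun w => log_kernel_reg e (z - w))).
Proof.
move=> L1.
pose GN N z w := \sum_(k < N) stereo_kernel z w ^+ k.+1 / k.+1%:R.
have cGN N z : continuous (GN N z : plane R -> R).
  elim: N => [|N IH]; rewrite /GN.
    by under eq_fun do rewrite big_ord0; exact: continuous_plane_cst.
  under eq_fun do rewrite big_ord_recr /=.
  apply: continuous_planeD => //; apply: continuous_planeM; last exact: continuous_plane_cst.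
  exact/continuous_planeX/continuous_stereo_kernel.
have GNp N : continuous (fun z : plane R => L (GN N z) : R) /\ 0 <= L (fun z => L (GN N z)).
  elim: N => [|N [cN pN]].
    have E z : GN 0%N z = fun=> 0 by apply/funext => w; rewrite /GN big_ord0.
    under eq_fun do rewrite E (functional0 linL)//.
    by split; [exact: continuous_plane_cst|rewrite (functional0 linL)].
  have [cK pK] := stereo_kernelX_posdef N.+1 (@continuous_plane_cst R 1).
  have E z : L (GN N.+1 z) = N.+1%:R^-1 * L (fun w => 1 * stereo_kernel z w ^+ N.+1) + L (GN N z).
    rewrite -linL//.
      congr L; apply/funext => w; rewrite /GN big_ord_recr /= addrC mul1r mulrC//.
    apply: continuous_planeM; first exact: continuous_plane_cst.
    exact/continuous_planeX/continuous_stereo_kernel.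
  under eq_fun do rewrite E.
  split.
    by apply: continuous_planeD => //; apply: continuous_planeM => //; exact: continuous_plane_cst.
  rewrite linL// addr_ge0// mulr_ge0 ?invr_ge0//.
  by move: pK; under eq_fun do rewrite mul1r.
pose G z w := - ln (1 - stereo_kernel z w).
pose U z := L (fun w => log_kernel_reg e (z - w)).
pose a z := ln (stereo_weight z).
have ca : continuous (a : plane R -> R) by exact: continuous_ln_stereo_weight.
have GE z : G z = fun w => 2 * log_kernel_reg e (z - w) + (1 * a w + (a z - ln 2)).
  by apply/funext => w; rewrite log_kernel_regE /G /a; ring.
have cG z : continuous (G z : plane R -> R).
  rewrite GE; apply: continuous_planeD; first apply: continuous_planeM.
  - exact: continuous_plane_cst.
  - exact: continuous_log_kernel_reg.
  apply: continuous_planeD; last exact: continuous_plane_cst.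
  by apply: continuous_planeM => //; exact: continuous_plane_cst.
have LG z : L (G z) = 2 * U z + L a.
  rewrite GE.
  rewrite linL; last 2 first.
  - exact: continuous_log_kernel_reg.
  - apply: continuous_planeD; last exact: continuous_plane_cst.
    by apply: continuous_planeM => //; exact: continuous_plane_cst.
  rewrite linL//; last exact: continuous_plane_cst.
  by rewrite (functional_cst linL (a z - ln 2)) L1 mulr0 addr0 mul1r.
have cU : continuous (U : plane R -> R) by exact: continuous_functional_log_kernel_reg.
have cLG : continuous (fun z : plane R => L (G z) : R).
  under eq_fun do rewrite LG.
  apply: continuous_planeD; last exact: continuous_plane_cst.
  by apply: continuous_planeM => //; exact: continuous_plane_cst.
have LLG : L (fun z => L (G z)) = 2 * L U.
  under eq_fun do rewrite LG.
  rewrite linL//; last exact: continuous_plane_cst.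
  by rewrite (functional_cst linL (L a)) L1 mulr0 addr0.
suff : 0 <= 2 * L U by rewrite pmulr_rge0.
rewrite -LLG.
pose F := 1 + (rho ^+ 2 + e ^+ 2 / 2).
have F0 : 1 <= F by rewrite /F lerDl addr_ge0 ?divr_ge0 ?sqr_ge0.
have wF z : S z -> stereo_weight z <= F.
  move=> /S_bounded zr; rewrite /F /stereo_weight lerD2l lerD2r.
  by rewrite lerXn2r ?nnegrE ?modulus_ge0// (le_trans (modulus_ge0 z)).
pose del := e ^+ 4 / (2 * (F * F)).
have F2 : 1 <= F * F by rewrite -[leLHS]mulr1 ler_pM.
have del0 : 0 < del by rewrite divr_gt0 ?exprn_gt0// mulr_gt0// (lt_le_trans ltr01).
have del1 : del <= 1.
  rewrite /del ler_pdivrMr; last by rewrite mulr_gt0// (lt_le_trans ltr01).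
  rewrite mul1r; have : e ^+ 4 <= 1 by rewrite expr_le1// ltW.
  lra.
have q01 : 0 <= 1 - del < 1 by rewrite subr_ge0 del1 /= ltrBlDr ltrDl.
have Kq z w : S z -> S w -> `|stereo_kernel z w| <= 1 - del.
  move=> Sz Sw; apply: le_trans (stereo_kernel_bound z w) _.
  rewrite lerD2l lerN2 /del ler_pM2l ?exprn_gt0//.
  rewrite lef_pV2 ?posrE ?mulr_gt0 ?stereo_weight_gt0 ?(lt_le_trans ltr01 F0)//.
  rewrite ler_pM2l// ler_pM ?wF// ltW ?stereo_weight_gt0//.
have step N : - (A * (A * ((1 - del) ^+ N / (1 - (1 - del))))) <= L (fun z => L (G z)).
  have [cN pN] := GNp N.
  have b1 z : S z -> `|L (G z) - L (GN N z)| <= A * ((1 - del) ^+ N / (1 - (1 - del))).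
    move=> Sz; rewrite -(functionalB linL)//; apply: domL.
      under eq_fun do rewrite -mulN1r.
      apply: continuous_planeD => //.
      by apply: continuous_planeM => //; exact: continuous_plane_cst.
    move=> w Sw; rewrite /G -opprD normrN; apply: ln_series_bound => //.
    exact: Kq.
  have : `|L (fun z => L (G z) - L (GN N z))| <= A * (A * ((1 - del) ^+ N / (1 - (1 - del)))).
    apply: domL => //.
    under eq_fun do rewrite -[- L (GN N _)]mulN1r.
    by apply: continuous_planeD => //; apply: continuous_planeM => //; exact: continuous_plane_cst.
  rewrite (functionalB linL)// ler_norml => /andP[+ _].
  by move=> /le_trans; apply; rewrite lerBlDr lerDl.
apply/ler_addgt0Pr => t t0.
have c0 : (fun N => - (A * (A * ((1 - del) ^+ N / (1 - (1 - del))))) : R) @ \oo --> (0 : R).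
  rewrite -oppr0; apply: cvgN; rewrite -[X in _ --> X](mulr0 (A * A / (1 - (1 - del)))).
  have -> : (fun N => A * (A * ((1 - del) ^+ N / (1 - (1 - del)))) : R) =
     (fun N => A * A / (1 - (1 - del)) * (1 - del) ^+ N).
    by apply/funext => N; ring.
  apply: cvgMl_tmp; apply: cvg_expr.
  by case/andP: q01 => q0 q1; rewrite ger0_norm.
have /cvgrPdist_lt/(_ _ t0)[N _ /(_ N (leqnn N))] := c0.
rewrite sub0r opprK => /(le_lt_trans (ler_norm _)) /ltW lt.
by have := step N; lra.
Qed.

End positive_definite.

(** * Means over a measure carried by a compact set *)

Lemma le_integral_nomeas d (T : measurableType d) (R : realType)
    (mu : {measure set T -> \bar R}) (f g : T -> \bar R) :
  (forall x, f x <= g x)%E -> (\int[mu]_x f x <= \int[mu]_x g x)%E.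
Proof.
move=> fg.
have mono (u v : T -> \bar R) : (forall x, 0 <= u x)%E -> (forall x, u x <= v x)%E ->
    (\int[mu]_x u x <= \int[mu]_x v x)%E.
  move=> u0 uv; have v0 x : (0 <= v x)%E by exact: le_trans (u0 x) (uv x).
  rewrite !ge0_integralTE//; apply: le_ereal_sup => _ [h hu <-]; exists h => // x.
  exact: le_trans (hu x) (uv x).
rewrite [leLHS]integralE [leRHS]integralE; apply: leeB; apply: mono => // x.
  by rewrite !funeposE ge_max le_max fg /= le_max lexx orbT.
by rewrite !funenegE ge_max !le_max leeN2 fg /= lexx orbT.
Qed.

Section mean.
Context {R : realType}.
Variables (E : set (plane R)) (mu : probability (borelC R) R).
Hypotheses (compE : compact E) (muE : prob_on E mu).
Implicit Types (f g : plane R -> R) (z w : R[i]).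

Definition mean f : R := (\int[mu]_z (f z : R))%R.

Lemma measurable_plane_closed (F : set (plane R)) : closed F ->
  measurable (F : set (borelC R)).
Proof.
move=> cF; rewrite -[F]setCK; apply: measurableC.
by apply: sub_sigma_algebra; exact: closed_openC.
Qed.

Lemma continuous_measurable_plane f : continuous f ->
  measurable_fun setT (f : borelC R -> R).
Proof.
move=> /continuousP cf; apply: (measurability _ (RGenOpens.measurableE R)).
move=> _ [_ [a [b ->] <-]]; rewrite setTI.
apply: sub_sigma_algebra; exact/cf/interval_open.
Qed.

Let mE : measurable (E : set (borelC R)).
Proof. exact: measurable_plane_closed (compact_closed_plane compE). Qed.

Lemma integrable_on_support f : continuous f ->
  mu.-integrable (E : set (borelC R)) (EFin \o (f : borelC R -> R)).
Proof.
move=> cf; apply: measurable_bounded_integrable => //.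
- by rewrite (le_lt_trans (probability_le1 _ _))// ltry.
- exact: measurable_funS (continuous_measurable_plane cf).
- have cc : compact (f @` E) by apply: continuous_compact => //; exact: continuous_subspaceT.
  have [M [Mr HM]] := compact_bounded cc.
  by exists M; split => // x Mx z Ez; apply: HM => //; exists z.
Qed.

Lemma integrable_continuous_plane f : continuous f ->
  mu.-integrable setT (EFin \o (f : borelC R -> R)).
Proof.
move=> cf.
have mN : measurable (~` E : set (borelC R)) by exact: measurableC.
have mf : measurable_fun (setT : set (borelC R)) (fun z => (f z)%:E).
  by apply/measurable_EFinP; exact: continuous_measurable_plane cf.
apply/(negligible_integrable mN (@measurableT _ _) mf muE).
by rewrite setTD setCK; exact: integrable_on_support.
Qed.

Lemma mean_EFin f : continuous f -> (\int[mu]_z (f z)%:E = (mean f)%:E)%E.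
Proof.
move=> cf; rewrite /mean /Rintegral fineK//.
exact: integrable_fin_num (integrable_continuous_plane cf).
Qed.

Lemma mean_support f : continuous f -> mean f = \int[mu]_(z in (E : set (borelC R))) f z.
Proof.
move=> cf; rewrite /mean /Rintegral.
have mN : measurable (~` E : set (borelC R)) by exact: measurableC.
rewrite (negligible_integral mN)//; first by rewrite setTD setCK.
exact: integrable_continuous_plane.
Qed.

Lemma mean_linear : linear_on_continuous mean.
Proof.
move=> a f g cf cg; rewrite /mean RintegralD//.
- by rewrite RintegralZl//; exact: integrable_continuous_plane.
- apply: integrable_continuous_plane.
  by apply: continuous_planeM => //; exact: continuous_plane_cst.
- exact: integrable_continuous_plane.
Qed.

Lemma mean1 : mean (fun=> 1) = 1.
Proof.
rewrite /mean Rintegral_cst// mul1r.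
exact: (congr1 fine (@probability_setT _ _ _ mu)).
Qed.

Lemma mean_le f g : continuous f -> continuous g -> (forall z, E z -> f z <= g z) ->
  mean f <= mean g.
Proof.
by move=> cf cg fg; rewrite !mean_support//; apply: le_Rintegral => //; exact: integrable_on_support.
Qed.

Lemma mean_dominated : dominated E 1 mean.
Proof.
move=> f B cf fB; rewrite mul1r ler_norml.
have mc (b : R) : mean (fun=> b) = b by rewrite (functional_cst mean_linear) mean1 mulr1.
apply/andP; split; [rewrite -[leLHS]mc|rewrite -[leRHS]mc];
  apply: mean_le => //; do 1?exact: continuous_plane_cst.
- by move=> z /fB; rewrite ler_norml => /andP[].
- by move=> z /fB; rewrite ler_norml => /andP[].
Qed.

Lemma energy_ge_reg (e : R) : 0 < e ->
  ((mean (fun z => mean (fun w => log_kernel_reg e (z - w))))%:E <= energy mu)%E.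
Proof.
move=> e0.
have pot z : ((mean (fun w => log_kernel_reg e (z - w)))%:E <= potential mu z)%E.
  rewrite -mean_EFin; last exact: continuous_log_kernel_reg.
  apply: le_integral_nomeas => w; rewrite /log_kernel.
  have [h|h] := leP (modulus (z - w)) 0; first by rewrite /= h leey.
  by rewrite lne_EFin// -EFinN lee_fin log_kernel_reg_le.
rewrite -mean_EFin; first exact: le_integral_nomeas.
exact: (continuous_functional_log_kernel_reg e0 ler01 mean_linear mean_dominated).
Qed.

Lemma measurable_log_kernel z : measurable_fun (setT : set (borelC R)) (log_kernel z).
Proof.
have mm : measurable_fun (setT : set (borelC R)) (fun t => modulus (z - t)).
  exact: (continuous_measurable_plane (@continuous_dist R z)).
rewrite (_ : log_kernel z =
    fun t => if modulus (z - t) <= 0 then +oo%E else (- ln (modulus (z - t)))%:E); last first.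
  by apply/funext => t; rewrite /log_kernel /=; case: ifP.
apply: measurable_fun_ifT.
- by apply: measurable_fun_ler => //; exact: measurable_cst.
- exact: measurable_cst.
- apply/measurable_EFinP.
  have ml := measurableT_comp (@measurable_ln R) mm.
  exact: measurable_funN ml.
Qed.

Lemma potential_far (d : R) z : 0 < d -> (forall t, E t -> d <= modulus (z - t)) ->
  exists2 u : R, potential mu z = u%:E & forall e, 0 < e ->
    mean (fun w => log_kernel_reg e (z - w)) <= u <=
    mean (fun w => log_kernel_reg e (z - w)) + (e / d) ^+ 2 / 2.
Proof.
move=> d0 dE.
pose h (t : plane R) : R := - ln (Num.max (modulus (z - t)) d).
have cg : continuous (fun t : plane R => ln (Num.max (modulus (z - t)) d) : R).
  move=> t.
  apply: (@continuous_comp (plane R) R R (fun t => Num.max (modulus (z - t)) d) (@ln R)).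
    apply: (@continuous_max R (plane R)); first exact: continuous_dist.
    exact: cst_continuous.
  by apply: continuous_ln; rewrite lt_max d0 orbT.
have ch : continuous h by move=> t; exact: (continuousN (cg t)).
have hE t : E t -> h t = - ln (modulus (z - t)).
  by move=> /dE dt; rewrite /h max_l.
exists (mean h) => [|e e0].
  rewrite /potential -mean_EFin//; apply: ae_eq_integral => //.
  - exact: measurable_log_kernel.
  - by apply/measurable_EFinP; exact: continuous_measurable_plane ch.
  exists (~` E); split => //; first exact: measurableC.
  move=> t /= nt Et; apply: nt => _; rewrite hE// /log_kernel lne_EFin ?EFinN//.
  exact: lt_le_trans (dE _ Et).
have ck : continuous ((fun w => log_kernel_reg e (z - w)) : plane R -> R).
  exact: continuous_log_kernel_reg.
have -> : mean (fun w => log_kernel_reg e (z - w)) + (e / d) ^+ 2 / 2 =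
    mean (fun w => log_kernel_reg e (z - w) + (e / d) ^+ 2 / 2).
  rewrite (functionalD mean_linear ck (@continuous_plane_cst R _)).
  by rewrite (functional_cst mean_linear ((e / d) ^+ 2 / 2)) mean1 mulr1.
apply/andP; split; apply: mean_le => //.
- move=> t Et; rewrite hE// log_kernel_reg_le//; exact: lt_le_trans (dE _ Et).
- by apply: continuous_planeD => //; exact: continuous_plane_cst.
- by move=> t Et; rewrite hE// log_kernel_reg_ge// dE.
Qed.

Lemma mean_exists_le f : continuous f -> exists2 z, E z & f z <= mean f.
Proof.
move=> cf; have E0 : E !=set0.
  apply: contrapT => /forallNP nE.
  have := mean_le (@continuous_plane_cst R 1) (@continuous_plane_cst R 0).
  rewrite mean1 (functional0 mean_linear) => /(_ (fun z Ez => False_ind _ (nE z Ez))).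
  by rewrite ler10.
have [z /set_mem Ez zmin] := compact_EVT_min E0 compE (continuous_subspaceT cf).
exists z => //; rewrite -[leLHS]mulr1 -mean1 -(functional_cst mean_linear).
apply: mean_le => //; first exact: continuous_plane_cst.
by move=> t Et; apply: zmin; rewrite inE.
Qed.

End mean.

(** * The outer domain and the minimum principle *)

Section outer_domain.
Context {R : realType}.
Implicit Types (z w t : R[i]).
Variable (E : set (plane R)).
Hypothesis compE : compact E.

Lemma OmegaN z : Omega E (Some z) -> ~ E z.
Proof. by move=> /connected_component_sub nE Ez; apply: nE; exists z. Qed.

Lemma Omega_connected_subset (B : set (sphere R)) p q : connected B ->
  B `<=` ~` (Some @` E) -> B p -> B q -> Omega E p -> Omega E q.
Proof.
move=> cB BE Bp Bq Op; rewrite /Omega; apply: connected_component_trans Op _.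
exact: connected_component_max Bp BE cB q Bq.
Qed.

Lemma continuous_sphere_line z w : continuous (fun a : R => Some (z + a%:C%C * w) : sphere R).
Proof.
move=> a; apply: (@continuous_comp R (plane R) (sphere R) (fun a : R => z + a%:C%C * w) Some).
  move=> A /nbhs_planeP[e e0 eA]; apply/nbhs_ballP; exists (e / (modulus w + 1)).
    by rewrite /= divr_gt0// ltr_wpDl ?modulus_ge0.
  move=> b; rewrite /ball /= => ab; apply: eA.
  have -> : z + a%:C%C * w - (z + b%:C%C * w) = (a - b)%:C%C * w by rewrite rmorphB; ring.
  rewrite Normc.normcM modulus_real.
  apply: (@le_lt_trans _ _ (`|a - b| * (modulus w + 1))).
    by rewrite ler_wpM2l ?lerDl.
  by rewrite -ltr_pdivlMr// ltr_wpDl ?modulus_ge0.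
exact: one_point_compactification_some_continuous.
Qed.

Lemma Omega_ball (r : R) z w : (forall t, E t -> r <= modulus (z - t)) -> modulus (z - w) < r ->
  Omega E (Some z) <-> Omega E (Some w).
Proof.
move=> rE zw.
pose B := (fun a : R => Some (z + a%:C%C * (w - z)) : sphere R) @` `[0, 1].
have cB : connected B.
  apply: connected_continuous_connected; first exact: segment_connected.
  exact/continuous_subspaceT/continuous_sphere_line.
have Bz : B (Some z).
  by exists 0; [rewrite /= in_itv /= lexx ler01|rewrite mul0r addr0].
have Bw : B (Some w).
  by exists 1; [rewrite /= in_itv /= lexx ler01|rewrite mul1r addrC subrK].
have BE : B `<=` ~` (Some @` E).
  move=> _ [a /= /itvP a01 <-] [t Et [tE]].
  have := rE _ Et; rewrite tE opprD addNKr normcN Normc.normcM modulus_real.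
  rewrite leNgt => /negP; apply; rewrite modulus_subC (le_lt_trans _ zw)//.
  by rewrite ler_piMl ?modulus_ge0// ger0_norm a01.
by split; exact: Omega_connected_subset cB BE _ _.
Qed.

(* The closure of the ray {a z : a >= 1} contains the point at infinity. *)
Lemma Omega_large (M : R) z : 0 < M -> (forall t, E t -> modulus t <= M) ->
  M < modulus z -> Omega E (Some z).
Proof.
move=> M0 EM Mz.
have z0 : 0 < modulus z by exact: lt_trans Mz.
pose B := (fun a : R => Some (0 + a%:C%C * z) : sphere R) @` `[1, +oo[.
have cB : connected B.
  apply: connected_continuous_connected; last exact/continuous_subspaceT/continuous_sphere_line.
  exact/connected_intervalP/interval_is_interval.
have BN : closure B None.
  move=> U [K [cK _] KU].
  have [b b0 Kb] := compact_plane_bounded cK.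
  pose a := 1 + b / modulus z.
  have a1 : 1 <= a by rewrite lerDl divr_ge0 ?ltW.
  exists (Some (0 + a%:C%C * z)); split; first by exists a => //=; rewrite in_itv /= a1.
  apply: KU; left; exists (0 + a%:C%C * z) => // /Kb.
  rewrite add0r Normc.normcM modulus_real ger0_norm ?(le_trans ler01)//.
  rewrite /a mulrDl mul1r divfK ?gt_eqF//; lra.
have BE : closure B `<=` ~` (Some @` E).
  move=> x + [t Et tx]; rewrite -tx => /(_ (Some @` [set w : plane R | modulus w < modulus z])) [].
    apply: one_point_compactification_some_nbhs; apply/nbhs_planeP.
    exists (modulus z - modulus t); first by rewrite subr_gt0 (le_lt_trans (EM _ Et)).
    move=> y /= ty; have := le_modulus_dist y t; rewrite modulus_subC ler_norml.
    by move=> /andP[_]; lra.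
  move=> _ [[a /= a1 <-] [w wz [wE]]]; move: a1 wz; rewrite in_itv /= andbT => a1.
  rewrite /= wE add0r Normc.normcM modulus_real ltNge => /negP; apply.
  by rewrite ler_peMl ?modulus_ge0// (le_trans a1)// ler_norm.
apply: (Omega_connected_subset (connected_closure cB) BE BN).
  apply: subset_closure; exists 1; first by rewrite /= in_itv /= lexx.
  by rewrite add0r mul1r.
apply: connected_component_refl; by case.
Qed.

Hypothesis E0 : E !=set0.

Lemma dist_to_le z t : E t -> dist_to E z <= modulus (z - t).
Proof.
move=> Et; apply: ge_inf; last by exists t.
by exists 0 => _ [s _ <-]; exact: modulus_ge0.
Qed.

Lemma dist_to_ge (r : R) z : (forall t, E t -> r <= modulus (z - t)) -> r <= dist_to E z.
Proof.
move=> rE; apply: lb_le_inf; first by case: E0 => t Et; exists (modulus (z - t)), t.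
by move=> _ [t Et <-]; exact: rE.
Qed.

Lemma dist_to_lipschitz z w : dist_to E z <= dist_to E w + modulus (z - w).
Proof.
rewrite -lerBlDr; apply: dist_to_ge => t Et; rewrite lerBlDr addrC.
by apply: le_trans (dist_to_le z Et) _; exact: modulus_dist.
Qed.

Definition filled_nbhd (r : R) : set (plane R) :=
  [set z | ~ Omega E (Some z) \/ dist_to E z <= r].

Lemma compact_filled_nbhd (r : R) : 0 < r -> compact (filled_nbhd r).
Proof.
move=> r0; have [M M0 EM] := compact_plane_bounded compE.
apply: (@bounded_closed_compact_plane _ _ (M + r)).
  rewrite -[filled_nbhd r]setCK; apply: open_closedC; rewrite openE => z.
  rewrite /filled_nbhd /= not_orP => -[/contrapT Oz /negP]; rewrite -ltNge => zr.
  apply/nbhs_planeP; exists (dist_to E z - r); first by rewrite subr_gt0.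
  move=> y zy; rewrite /= not_orP; split.
    apply: contraPnot Oz => nOy; rewrite (@Omega_ball (dist_to E z) z y)//.
      by move=> t Et; exact: dist_to_le.
    by rewrite (lt_le_trans zy)// gerBl ltW.
  apply/negP; rewrite -ltNge; have := dist_to_lipschitz z y; lra.
move=> z [nO|dr].
  rewrite leNgt; apply/negP => Mz; apply: nO; apply: (@Omega_large M) => //.
  by rewrite (le_lt_trans _ Mz)// lerDl ltW.
rewrite leNgt; apply/negP => Mz.
have : r < dist_to E z.
  apply: (@lt_le_trans _ _ (modulus z - M)); first by rewrite ltrBrDr addrC.
  apply: dist_to_ge => t Et; have := le_modulus_dist z t; rewrite ler_norml => /andP[_].
  by have := EM _ Et; lra.
by rewrite ltNge dr.
Qed.

Lemma filled_nbhd_interior (r : R) z : 0 < r -> filled_nbhd r z ->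
  ~ (Omega E (Some z) /\ dist_to E z = r) ->
  exists2 h : R, 0 < h & forall w, modulus (z - w) < h -> filled_nbhd r w.
Proof.
move=> r0 Kz nB; have [dr|rd] := ltP (dist_to E z) r.
  exists (r - dist_to E z); first by rewrite subr_gt0.
  move=> w zw; right; have := dist_to_lipschitz w z; rewrite modulus_subC; lra.
exists r => // w zw; left.
have nO : ~ Omega E (Some z).
  case: Kz => // dr; move: nB => /not_andP[//|nd] _.
  by apply: nd; apply/eqP; rewrite eq_le dr rd.
rewrite -(@Omega_ball r z w)// => t Et; exact: le_trans rd (dist_to_le z Et).
Qed.

End outer_domain.

Section minimum_principle.
Context {R : realType}.
Implicit Types (z w : R[i]) (f : plane R -> R) (e h : R).

Definition four_point_superharmonic e f := forall z h, 0 < h <= e ->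
  f (z + h%:C%C) + f (z - h%:C%C) + f (z + (h *i)%C) + f (z - (h *i)%C) <= 4 * f z.

Lemma log_kernel_reg_superharmonic e w : 0 < e ->
  four_point_superharmonic e (fun z => log_kernel_reg e (z - w)).
Proof.
move=> e0 z h /andP[h0 he].
rewrite !(addrAC z _ (- w)); move: (z - w) => {w z} z.
have p := reg_arg_gt0 _ e0.
have le1 : ln ((modulus z ^+ 2 + e ^+ 2) ^+ 4) <=
   ln ((modulus (z + h%:C%C) ^+ 2 + e ^+ 2) * (modulus (z - h%:C%C) ^+ 2 + e ^+ 2) *
   ((modulus (z + (h *i)%C) ^+ 2 + e ^+ 2) * (modulus (z - (h *i)%C) ^+ 2 + e ^+ 2))).
  rewrite ler_ln ?posrE ?exprn_gt0 ?mulr_gt0//.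
  rewrite !sqr_modulus; case: z => a b /=; rewrite !(subr0, addr0, add0r, oppr0).
  have s0 : 0 < e ^+ 2 by rewrite exprn_gt0.
  have H0 : 0 < h ^+ 2 by rewrite exprn_gt0.
  have Hs : h ^+ 2 <= e ^+ 2 by rewrite lerXn2r ?nnegrE ?(ltW h0) ?(ltW e0).
  set s := e ^+ 2 in s0 Hs *.
  rewrite -subr_ge0.
  have -> : ((a + h) ^+ 2 + b ^+ 2 + s) * ((a - h) ^+ 2 + b ^+ 2 + s) *
     ((a ^+ 2 + (b + h) ^+ 2 + s) * (a ^+ 2 + (b - h) ^+ 2 + s)) -
     (a ^+ 2 + b ^+ 2 + s) ^+ 4 =
     16 * (h ^+ 2 * a * b) ^+ 2 + h ^+ 8 +
     h ^+ 2 * (2 * (a ^+ 2 + b ^+ 2 + s) ^+ 2 * (2 * s - h ^+ 2) +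
       4 * s * (h ^+ 4 + 2 * (a ^+ 2 + b ^+ 2 + s) * h ^+ 2)) by ring.
  have q0 : 0 <= a ^+ 2 + b ^+ 2 + s by rewrite !addr_ge0 ?sqr_ge0// ltW.
  have h4 : 0 <= h ^+ 4 by rewrite exprn_ge0 ?ltW.
  apply: addr_ge0.
    by apply: addr_ge0; [rewrite mulr_ge0 ?sqr_ge0|rewrite exprn_ge0 ?ltW].
  apply: mulr_ge0; first exact: ltW.
  apply: addr_ge0.
    apply: mulr_ge0; first by rewrite mulr_ge0 ?sqr_ge0.
    by rewrite subr_ge0; lra.
  apply: mulr_ge0; first by rewrite mulr_ge0 ?ltW.
  by apply: addr_ge0 => //; rewrite !mulr_ge0// ltW.
move: le1; rewrite lnXn// !lnM ?posrE ?mulr_gt0// /log_kernel_reg -[_ *+ 4]mulr_natl; lra.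
Qed.

(* Among the minimizers of f on K, one with the largest real part must lie in B. *)
Lemma minimum_principle (K B : set (plane R)) e f : 0 < e -> compact K -> continuous f ->
  four_point_superharmonic e f ->
  (forall z, K z -> ~ B z -> exists2 h : R, 0 < h & forall w, modulus (z - w) < h -> K w) ->
  forall z, K z -> exists b, [/\ K b, B b & f b <= f z].
Proof.
move=> e0 cK cf sf intK z Kz.
have Kne : K !=set0 by exists z.
have [c /set_mem Kc cmin] := compact_EVT_min Kne cK (continuous_subspaceT cf).
pose K' := K `&` [set w | f w <= f c].
have cK' : compact K'.
  apply: (subclosed_compact _ cK) => [|w []//].
  apply: closedI; first exact: compact_closed_plane.
  exact: (preimage_closed (fun x _ => cf x) (@closed_le R (f c))).
have K'ne : K' !=set0 by exists c; split => /=.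
have [c' /set_mem [Kc' fc'] cmax] := compact_EVT_max K'ne cK'
   (continuous_subspaceT (@continuous_Re R)).
exists c'; split => //; last by apply: le_trans fc' _; apply: cmin; rewrite inE.
apply: contrapT => nB.
have [h0 h00 hK] := intK _ Kc' nB.
pose h := Num.min e (h0 / 2).
have hgt0 : 0 < h by rewrite lt_min e0 divr_gt0.
have hh0 : h < h0.
  by rewrite gt_min; apply/orP; right; lra.
have he : 0 < h <= e by rewrite hgt0 ge_min lexx.
have mi : modulus ((h *i)%C) = h by rewrite /= expr0n /= add0r sqrtr_sqr gtr0_norm.
have mr : modulus (h%:C%C) = h by rewrite modulus_real gtr0_norm.
have K1 : K (c' + h%:C%C) by apply: hK; rewrite opprD addNKr normcN mr.
have K2 : K (c' - h%:C%C) by apply: hK; rewrite subKr mr.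
have K3 : K (c' + (h *i)%C) by apply: hK; rewrite opprD addNKr normcN mi.
have K4 : K (c' - (h *i)%C) by apply: hK; rewrite subKr mi.
have m2 := cmin _ (mem_set K2); have m3 := cmin _ (mem_set K3); have m4 := cmin _ (mem_set K4).
have sum4 := sf c' h he; have fc : f c' <= f c by exact: fc'.
have : K' (c' + h%:C%C) by split => //=; lra.
move=> /mem_set /cmax; case: (c') => a b /=; lra.
Qed.

End minimum_principle.

(** * Vandermonde determinants *)

Section vandermonde_bounds.
Context {R : realType}.
Implicit Types (z w : R[i]) (E : set (plane R)).

Lemma modulus_prod (I : Type) (r : seq I) (P : pred I) (F : I -> R[i]) :
  modulus (\prod_(i <- r | P i) F i) = \prod_(i <- r | P i) modulus (F i) :> R.
Proof.
by apply: (big_morph (fun z : R[i] => modulus z : R) (@Normc.normcM R) (@Normc.normc1 R)).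
Qed.

Lemma modulus_sum (I : Type) (r : seq I) (P : pred I) (F : I -> R[i]) :
  modulus (\sum_(i <- r | P i) F i) <= \sum_(i <- r | P i) modulus (F i) :> R.
Proof.
elim/big_rec2: _ => [|i y1 y2 _ le]; first by rewrite Normc.normc0.
by apply: le_trans (le_normcD _ _) _; rewrite lerD2l.
Qed.

Lemma modulus_vandermonde n (Z : 'I_n -> R[i]) : modulus (vandermonde Z) =
  \prod_(j < n) \prod_(k < n | (j < k)%N) modulus (Z j - Z k) :> R.
Proof. by rewrite modulus_prod; apply: eq_bigr => j _; rewrite modulus_prod. Qed.

Lemma vandermonde_monic_bound n (P : nat -> {poly R[i]}) (N : nat -> R) (W : 'I_n -> R[i]) :
  (forall i, P i \is monic) -> (forall i, size (P i) = i.+1) ->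
  (forall i j, modulus (P i).[W j] <= N i) ->
  modulus (vandermonde W) <= n`!%:R * \prod_(i < n) N i.
Proof.
move=> mP sP PN.
pose A : 'M[R[i]]_n := \matrix_(i, j) (P i).[W j].
pose Lc : 'M[R[i]]_n := \matrix_(i, j) (P i)`_j.
have AE : A = Lc *m Vandermonde n (\row_j W j).
  apply/matrixP => i j; rewrite !mxE horner_coef sP.
  rewrite (big_ord_widen n (fun k => (P i)`_k * W j ^+ k)) ?ltn_ord//.
  rewrite big_mkcond; apply: eq_bigr => k _; rewrite !mxE.
  case: ifPn => //; rewrite -leqNgt => ik.
  by rewrite nth_default ?mul0r// sP.
have detL : \det Lc = 1.
  rewrite det_trig; last first.
    by apply/is_trig_mxP => i j ij; rewrite mxE nth_default// sP.
  apply: big1 => i _; rewrite mxE.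
  by have := monicP (mP i); rewrite /lead_coef sP.
have detA : modulus (\det A) = modulus (vandermonde W) :> R.
  rewrite AE det_mulmx detL mul1r det_Vandermonde modulus_vandermonde modulus_prod.
  apply: eq_bigr => j _; rewrite modulus_prod; apply: eq_bigr => k _.
  by rewrite !mxE modulus_subC.
rewrite -detA /determinant; apply: le_trans (modulus_sum _ _ _) _.
rewrite -card_Sn mulr_natl -sumr_const; apply: ler_sum => s _.
rewrite Normc.normcM -signr_odd modulus_prod.
have -> : modulus ((-1) ^+ (odd s) : R[i]) = 1 :> R.
  by case: odd; rewrite ?expr0 ?expr1 ?normcN Normc.normc1.
rewrite mul1r; apply: ler_prod => i _.
by rewrite modulus_ge0 /= mxE PN.
Qed.

Lemma vandermonde_eq0 n (W : 'I_n -> R[i]) : ~ injective W -> vandermonde W = 0.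
Proof.
move=> ninjW; have [j [k [jk Wjk]]] : exists j k : 'I_n, (j < k)%N /\ W j = W k.
  apply: contrapT => nex; apply: ninjW => j k Wjk.
  have [jk|kj|/val_inj//] := ltngtP j k.
    by case: nex; exists j, k.
  by case: nex; exists k, j.
by rewrite /vandermonde (bigD1 j)//= (bigD1 k)//= Wjk subrr !mul0r.
Qed.

Lemma fekete_or_leja_in E n (Z : 'I_n -> R[i]) k : fekete_or_leja E Z -> E (Z k).
Proof. by move=> [[_ EZ _]//|[xi [xiE _] ->]]. Qed.

Lemma fekete_or_leja_vandermonde E n (Z W : 'I_n -> R[i]) : fekete_or_leja E Z ->
  (forall k, E (W k)) -> modulus (vandermonde W) <= n`!%:R * modulus (vandermonde Z).
Proof.
move=> FL EW; case: FL => [[_ EZ Zmax]|[xi [xiE ximax] Zxi]].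
  apply: (@le_trans _ _ (modulus (vandermonde Z))); last first.
    by rewrite ler_peMl ?modulus_ge0// ler1n fact_gt0.
  have [injW|ninjW] := pselect (injective W); first exact: Zmax.
  by rewrite (vandermonde_eq0 ninjW) Normc.normc0 modulus_ge0.
pose P i : {poly R[i]} := \prod_(k < i) ('X - (xi k)%:P).
have PE i z : modulus (P i).[z] = \prod_(k < i) modulus (z - xi k) :> R.
  by rewrite horner_prod modulus_prod; apply: eq_bigr => k _; rewrite !hornerE.
have -> : modulus (vandermonde Z) = \prod_(i < n) modulus (P i).[xi i] :> R.
  rewrite modulus_vandermonde.
  rewrite (exchange_big_dep predT)//=; apply: eq_bigr => k _.
  rewrite PE (big_ord_widen n (fun j => modulus (xi k - xi j) : R)); last exact: ltnW.
  by apply: eq_bigr => j _; rewrite !Zxi modulus_subC.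
apply: (@vandermonde_monic_bound n P (fun i => modulus (P i).[xi i])) => [i|i|i j].
- exact: monic_prod_XsubC.
- by rewrite size_prod_XsubC /index_enum -enumT size_enum_ord.
- rewrite !PE; case: i => [|i]; first by rewrite !big_ord0.
  exact: ximax.
Qed.

Lemma prod_addr_le (I : Type) (r : seq I) (Q : pred I) (a : I -> R) (A e : R) :
  (forall i, 0 <= a i <= A) -> 0 <= e <= 1 ->
  \prod_(i <- r | Q i) (a i + e) <=
    \prod_(i <- r | Q i) a i + e * ((size r)%:R * (A + 1) ^+ size r).
Proof.
move=> aA /andP[e0 e1].
elim: r => [|i r IH]; first by rewrite !big_nil /= mul0r mulr0 addr0.
have /andP[ai0 aiA] := aA i.
have A0 : 0 <= A by exact: le_trans ai0 aiA.
have K1 : 1 <= (A + 1) ^+ size r by rewrite exprn_ege1// lerDr.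
have K0 : 0 <= (A + 1) ^+ size r by exact: le_trans ler01 K1.
have P0 : 0 <= \prod_(i <- r | Q i) a i.
  by apply: prodr_ge0 => j _; case/andP: (aA j).
have PK : \prod_(i <- r | Q i) a i <= (A + 1) ^+ size r.
  elim: (r) => [|j r' IH']; first by rewrite big_nil.
  rewrite big_cons /= exprS; case/andP: (aA j) => aj0 ajA.
  have le' : 0 <= \prod_(j0 <- r' | Q j0) a j0.
    by apply: prodr_ge0 => k _; case/andP: (aA k).
  case: (Q j).
    by rewrite ler_pM// (le_trans ajA)// lerDl.
  by rewrite -[leLHS]mul1r ler_pM// lerDr.
rewrite !big_cons /= exprS.
move: (\prod_(j <- r | Q j) (a j + e)) (\prod_(j <- r | Q j) a j) ((A + 1) ^+ size r)
  IH K1 K0 P0 PK => X P K IH K1 K0 P0 PK.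
have N0 : 0 <= (size r)%:R :> R by [].
have NK0 : 0 <= (size r)%:R * K by rewrite mulr_ge0.
have N1 : (size r).+1%:R = (size r)%:R + 1 :> R by rewrite -addn1 natrD.
have h1 : 0 <= e * ((size r)%:R * K) by rewrite mulr_ge0.
have h2 : (size r)%:R * K <= (size r)%:R * ((A + 1) * K).
  by rewrite ler_wpM2l// ler_peMl// lerDr.
have h3 : K <= (A + 1) * K by rewrite ler_peMl// lerDr.
rewrite N1; case: (Q i).
  have s1 : (a i + e) * X <= (a i + e) * (P + e * ((size r)%:R * K)).
    by rewrite ler_wpM2l// addr_ge0.
  apply: le_trans s1 _.
  have s2 : (a i + e) * (e * ((size r)%:R * K)) <= (A + 1) * (e * ((size r)%:R * K)).
    by rewrite ler_wpM2r// lerD.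
  have s3 : e * P <= e * ((A + 1) * K) by rewrite ler_wpM2l// (le_trans PK).
  lra.
apply: le_trans IH _; rewrite lerD2l ler_wpM2l//.
by rewrite (le_trans h2)// ler_wpM2r ?mulr_ge0 ?lerDl ?addr_ge0.
Qed.

End vandermonde_bounds.

Section greedy.
Context {R : realType}.
Variables (E : set (plane R)) (mu : probability (borelC R) R).
Hypotheses (compE : compact E) (muE : prob_on E mu).
Implicit Types (z w : R[i]) (s : seq R[i]).

Fixpoint pair_energy (e : R) s : R :=
  if s is x :: s' then \sum_(y <- s') log_kernel_reg e (x - y) + pair_energy e s' else 0.

Lemma pair_energyE e s : pair_energy e s =
  \sum_(j < size s) \sum_(k < size s | (j < k)%N) log_kernel_reg e (s`_j - s`_k).
Proof.
elim: s => [|x s IH] /=; first by rewrite big_ord0.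
rewrite big_ord_recl IH; congr (_ + _).
  rewrite [RHS]big_mkcond big_ord_recl /= add0r (big_nth 0) big_mkord.
  by apply: eq_bigr.
apply: eq_bigr => j _; rewrite [RHS]big_mkcond big_ord_recl /= add0r.
by rewrite big_mkcond; apply: eq_bigr.
Qed.

Definition reg_potential (e : R) z : R := mean mu (fun w => log_kernel_reg e (z - w)).

Definition reg_energy (e : R) : R := mean mu (reg_potential e).

Lemma continuous_reg_potential e : 0 < e -> continuous (reg_potential e : plane R -> R).
Proof.
move=> e0; apply: (continuous_functional_log_kernel_reg e0 ler01 _ _).
  exact: mean_linear compE muE.
exact: mean_dominated compE muE.
Qed.

Lemma greedy_points e m k : 0 < e -> exists s, [/\ size s = m, (forall x, x \in s -> E x) &
  pair_energy e s + k%:R * \sum_(x <- s) reg_potential e x <=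
    ('C(m, 2) + m * k)%:R * reg_energy e].
Proof.
move=> e0; have linM := mean_linear compE muE; have cU := continuous_reg_potential e0.
elim: m k => [|m IH] k; first by exists [::]; rewrite /= big_nil mulr0 addr0 bin0n mul0n mul0r.
have [s [sm sE se]] := IH k.+1.
have ck y : continuous ((fun x => log_kernel_reg e (x - y)) : plane R -> R).
  by under eq_fun do rewrite log_kernel_reg_subC; exact: continuous_log_kernel_reg.
have cs : continuous ((fun x => \sum_(y <- s) log_kernel_reg e (x - y)) : plane R -> R).
  elim: (s) => [|y s' IHs]; first by under eq_fun do rewrite big_nil; exact: cst_continuous.
  by under eq_fun do rewrite big_cons; exact: continuous_planeD.
have [x Ex xle] := mean_exists_le compE muE
  (continuous_planeD (continuous_planeM (@continuous_plane_cst R k%:R) cU) cs).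
exists (x :: s); split => [|y|].
- by rewrite /= sm.
- by rewrite inE => /predU1P[->//|/sE].
have symU y : mean mu (fun x => log_kernel_reg e (x - y)) = reg_potential e y.
  by rewrite /reg_potential; congr mean; apply/funext => w; rewrite log_kernel_reg_subC.
move: xle; rewrite linM// (functional_sum linM)//.
under [X in _ <= _ + X]eq_bigr do rewrite symU.
rewrite -/(reg_energy e) /= big_cons => xle.
have -> : ('C(m.+1, 2) + m.+1 * k)%N = ('C(m, 2) + m * k.+1 + k)%N.
  by rewrite binS bin1 mulSn mulnS; lia.
rewrite natrD mulrDl; move: se xle; rewrite -[k.+1]addn1 natrD; lra.
Qed.

Lemma exp_reg_energy_le n (B V : R) : 
  (forall e, 0 < e <= 1 -> reg_energy e <= V) ->
  (forall W : 'I_n -> R[i], (forall k, E (W k)) -> modulus (vandermonde W) <= B) ->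
  expR (- ('C(n, 2)%:R * V)) <= B.
Proof.
move=> IV HB; have [M M0 EM] := compact_plane_bounded compE.
pose c : R := #|[the finType of ('I_n * 'I_n)%type]|%:R * (2 * M + 1) ^+ #|[the finType of ('I_n * 'I_n)%type]|.
have c0 : 0 <= c by rewrite mulr_ge0// exprn_ge0// addr_ge0// mulr_ge0// ltW.
have key e : 0 < e <= 1 -> expR (- ('C(n, 2)%:R * V)) <= B + e * c.
  move=> /andP[e0 e1].
  have [s [sn sE se]] := greedy_points n 0 e0.
  move: se; rewrite mul0r addr0 muln0 addn0 pair_energyE sn => se.
  pose W (k : 'I_n) := s`_k.
  have EW k : E (W k) by apply: sE; rewrite mem_nth// sn.
  apply: (@le_trans _ _ (expR (- \sum_(j < n) \sum_(k < n | (j < k)%N) log_kernel_reg e (W j - W k)))).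
    rewrite ler_expR lerN2; apply: le_trans se _.
    by rewrite ler_wpM2l// IV// e0 e1.
  rewrite -sumrN expR_sum.
  under eq_bigr do rewrite -sumrN expR_sum.
  apply: (@le_trans _ _ (\prod_(j < n) \prod_(k < n | (j < k)%N) (modulus (W j - W k) + e))).
    apply: ler_prod => j _; apply/andP; split.
      by apply: prodr_ge0 => k _; exact: expR_ge0.
    apply: ler_prod => k _; rewrite expR_ge0 /=.
    have w0 := modulus_ge0 (W j - W k).
    have p0 : 0 < modulus (W j - W k) + e by rewrite ltr_wpDl.
    rewrite -[leRHS]lnK ?posrE// ler_expR /log_kernel_reg.
    have : ln (modulus (W j - W k) ^+ 2 + e ^+ 2) <= ln ((modulus (W j - W k) + e) ^+ 2).
      rewrite ler_ln ?posrE ?exprn_gt0 ?reg_arg_gt0// sqrrD lerD2r lerDl.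
      by rewrite mulrn_wge0// mulr_ge0// ltW.
    rewrite lnXn// -[_ *+ 2]mulr_natl; lra.
  rewrite pair_big_dep /=.
  apply: le_trans (@prod_addr_le _ _ _ _ _ (2 * M) e _ _) _.
  - move=> [j k] /=; rewrite modulus_ge0 /=.
    apply: le_trans (modulus_dist _ 0 _) _; rewrite subr0 sub0r normcN.
    by have := EM _ (EW j); have := EM _ (EW k); lra.
  - by rewrite ltW.
  rewrite -(pair_big_dep xpredT (fun j k : 'I_n => (j < k)%N) (fun j k => modulus (W j - W k) : R)) /=.
  rewrite -modulus_vandermonde /index_enum -enumT -cardE lerD//; exact: HB.
apply/ler_addgt0Pr => t t0.
pose e := Num.min 1 (t / (c + 1)).
have c1 : 0 < c + 1 by rewrite ltr_wpDl.
have e01 : 0 < e <= 1 by rewrite lt_min ltr01 divr_gt0//= ge_min lexx.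
apply: le_trans (key e e01) _; rewrite lerD2l.
apply: (@le_trans _ _ (t / (c + 1) * (c + 1))); last by rewrite divfK ?gt_eqF.
case/andP: e01 => e0 _; apply: ler_pM => //; [exact: ltW| |by rewrite lerDl].
by rewrite ge_min lexx orbT.
Qed.

End greedy.

(** * The regularized discrepancy *)

Lemma ln_prod {R : realType} (I : Type) (r : seq I) (P : pred I) (F : I -> R) :
  (forall i, P i -> 0 < F i) ->
  ln (\prod_(i <- r | P i) F i) = \sum_(i <- r | P i) ln (F i).
Proof.
move=> F0; suff [] : 0 < \prod_(i <- r | P i) F i /\
  ln (\prod_(i <- r | P i) F i) = \sum_(i <- r | P i) ln (F i) by [].
apply: (big_rec2 (fun a b => 0 < a /\ ln a = b)); first by rewrite ln1.
by move=> i a b Pi [a0 <-]; rewrite mulr_gt0 ?F0// lnM ?posrE ?F0.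
Qed.

Section discrepancy.
Context {R : realType}.
Variables (E : set (plane R)) (mu : probability (borelC R) R).
Hypotheses (compE : compact E) (muE : prob_on E mu).
Implicit Types (z w p q : R[i]) (e : R).

Definition counting_mean n (Z : 'I_n -> R[i]) (f : plane R -> R) : R :=
  n%:R^-1 * \sum_(k < n) f (Z k).

Definition counting_potential n (Z : 'I_n -> R[i]) e z : R :=
  counting_mean Z (fun w => log_kernel_reg e (z - w)).

(* Energy of (counting measure) - mu for the regularized kernel. *)
Definition discrepancy n (Z : 'I_n -> R[i]) e : R :=
  counting_mean Z (counting_potential Z e) - 2 * counting_mean Z (reg_potential mu e)
  + reg_energy mu e.

Section counting.
Variables (n : nat) (Z : 'I_n -> R[i]).
Hypotheses (n0 : (0 < n)%N) (ZE : forall k, E (Z k)).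

Let N0 : 0 < n%:R :> R. Proof. by rewrite ltr0n. Qed.

Lemma counting_mean_cst (a : R) : counting_mean Z (fun=> a) = a.
Proof.
by rewrite /counting_mean sumr_const card_ord -[a *+ n]mulr_natl mulKf ?gt_eqF.
Qed.

Lemma counting_mean_linear : linear_on_continuous (counting_mean Z).
Proof.
move=> a f g _ _; rewrite /counting_mean big_split /= -mulr_sumr; ring.
Qed.

Lemma counting_mean_le (f g : plane R -> R) : (forall k, f (Z k) <= g (Z k)) ->
  counting_mean Z f <= counting_mean Z g.
Proof. by move=> fg; rewrite /counting_mean ler_pM2l ?invr_gt0// ler_sum. Qed.

Lemma counting_mean_dominated (S : set (plane R)) : (forall k, S (Z k)) ->
  dominated S 1 (counting_mean Z).
Proof.
move=> ZS f B _ fB; rewrite mul1r ler_norml -[- B]counting_mean_cst.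
have h k : - B <= f (Z k) <= B by rewrite -ler_norml fB.
rewrite counting_mean_le /=; last by move=> k; case/andP: (h k).
by rewrite -[leRHS]counting_mean_cst counting_mean_le// => k; case/andP: (h k).
Qed.

Lemma continuous_counting_potential e : 0 < e ->
  continuous (counting_potential Z e : plane R -> R).
Proof.
move=> e0; apply: (continuous_functional_log_kernel_reg e0 ler01 counting_mean_linear).
exact: (@counting_mean_dominated setT).
Qed.

Lemma counting_potential_superharmonic e : 0 < e ->
  four_point_superharmonic e (counting_potential Z e).
Proof.
move=> e0 z h he; rewrite /counting_potential /counting_mean -!mulrDr -!big_split /=.
rewrite mulrCA ler_pM2l ?invr_gt0// mulr_sumr ler_sum// => k _.
exact: log_kernel_reg_superharmonic.
Qed.

Lemma discrepancy_form e x p q : 0 < e <= 1 ->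
  0 <= discrepancy Z e +
    2 * x * ((counting_potential Z e p - reg_potential mu e p) -
             (counting_potential Z e q - reg_potential mu e q)) +
    x ^+ 2 * (2 * log_kernel_reg e 0 - 2 * log_kernel_reg e (p - q)).
Proof.
move=> /andP[e0 e1].
have linM := mean_linear compE muE; have domM := mean_dominated compE muE.
pose T := counting_mean Z.
pose L (f : plane R -> R) : R := T f - mean mu f + x * (f p - f q).
pose S : set (plane R) := E `|` [set p] `|` [set q].
have linL : linear_on_continuous L.
  by move=> a f g cf cg; rewrite /L linM// /T counting_mean_linear//; ring.
have A0 : 0 <= 2 + `|x| * 2 by rewrite addr_ge0// mulr_ge0.
have domL : dominated S (2 + `|x| * 2) L.
  move=> f B cf fB.
  have T1 : `|T f| <= 1 * B by apply: (@counting_mean_dominated S) => // k; left; left.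
  have M1 : `|mean mu f| <= 1 * B by apply: domM => // z Ez; apply: fB; left; left.
  have p1 : `|f p| <= B by apply: fB; left; right.
  have q1 : `|f q| <= B by apply: fB; right.
  rewrite /L; apply: le_trans (ler_normD _ _) _; rewrite mulrDl; apply: lerD.
    by apply: le_trans (ler_normB _ _) _; lra.
  rewrite normrM -mulrA ler_wpM2l//; apply: le_trans (ler_normB _ _) _; lra.
have [M M0 EM] := compact_plane_bounded compE.
have bS z : S z -> modulus z <= M + modulus p + modulus q.
  have p0 := modulus_ge0 p; have q0 := modulus_ge0 q.
  by move=> [[/EM zM|->]|->]; lra.
have L1 : L (fun=> 1) = 0.
  by rewrite /L /T counting_mean_cst (mean1 mu) !subrr mulr0 addr0.
have := log_kernel_reg_posdef e0 e1 A0 linL domL bS L1.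
have ck z : continuous ((fun w => log_kernel_reg e (z - w)) : plane R -> R).
  exact: continuous_log_kernel_reg.
have ck' z : continuous ((fun w => log_kernel_reg e (w - z)) : plane R -> R).
  by under eq_fun do rewrite log_kernel_reg_subC; exact: ck.
have Mk z : mean mu (fun w => log_kernel_reg e (w - z)) = reg_potential mu e z.
  by rewrite /reg_potential; congr mean; apply/funext => w; rewrite log_kernel_reg_subC.
have Tk z : T (fun w => log_kernel_reg e (w - z)) = counting_potential Z e z.
  rewrite /counting_potential -/T; congr T.
  by apply/funext => w; rewrite log_kernel_reg_subC.
have cU := continuous_reg_potential compE muE e0.
have cT := continuous_counting_potential e0.
have MT : mean mu (counting_potential Z e) = T (reg_potential mu e).
  rewrite /T /counting_mean /counting_potential /counting_mean.
  rewrite (functionalZ linM); last first.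
    elim: (index_enum _) => [|k r IH].
      by under eq_fun do rewrite big_nil; exact: continuous_plane_cst.
    by under eq_fun do rewrite big_cons; exact: continuous_planeD.
  rewrite (functional_sum linM); last by move=> k; exact: ck'.
  by congr (_ * _); apply: eq_bigr => k _; exact: Mk.
have LE z : L (fun w => log_kernel_reg e (z - w)) =
    1 * (counting_potential Z e z) + ((-1) * reg_potential mu e z +
     (x * log_kernel_reg e (z - p) + (- x) * log_kernel_reg e (z - q))).
  by rewrite /L /T /reg_potential /counting_potential; ring.
have cZ a f : continuous (f : plane R -> R) -> continuous ((fun w => a * f w) : plane R -> R).
  by move=> cf; apply: continuous_planeM => //; exact: continuous_plane_cst.
have c1 : continuous ((fun z => (- x) * log_kernel_reg e (z - q)) : plane R -> R).
  exact/cZ/ck'.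
have c2 : continuous ((fun z => x * log_kernel_reg e (z - p) +
     (- x) * log_kernel_reg e (z - q)) : plane R -> R).
  by apply: continuous_planeD => //; exact/cZ/ck'.
have c3 : continuous ((fun z => (-1) * reg_potential mu e z + (x * log_kernel_reg e (z - p) +
     (- x) * log_kernel_reg e (z - q))) : plane R -> R).
  by apply: continuous_planeD => //; exact: cZ.
under eq_fun do rewrite LE.
have linT := counting_mean_linear.
rewrite {1}/L (linM 1 _ _ cT c3) (linM (-1) _ _ cU c2) (linM x _ _ (ck' p) c1).
rewrite (functionalZ linM (- x) (ck' q)) !Mk MT.
rewrite /T (linT 1 _ _ cT c3) (linT (-1) _ _ cU c2) (linT x _ _ (ck' p) c1).
rewrite (functionalZ linT (- x) (ck' q)) -/T !Tk /discrepancy -/T -/(reg_energy mu e).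
rewrite !subrr (log_kernel_reg_subC e q p) => le0; apply: le_trans le0 _.
by rewrite le_eqVlt; apply/orP; left; apply/eqP; ring.
Qed.

Lemma discrepancy_ge0 e : 0 < e <= 1 -> 0 <= discrepancy Z e.
Proof.
move=> e01; have := @discrepancy_form e 0 0 0 e01.
by rewrite mulr0 mul0r addr0 expr0n /= mul0r addr0.
Qed.

Lemma counting_energy_le e : 0 < e -> injective Z ->
  counting_mean Z (counting_potential Z e) <=
    - ln e / n%:R - 2 * ln (modulus (vandermonde Z)) / n%:R ^+ 2.
Proof.
move=> e0 injZ.
have dist_gt0 j k : j != k -> 0 < modulus (Z j - Z k).
  move=> jk; rewrite lt0r modulus_ge0 andbT; apply: contra jk => /eqP /Normc.eq0_normc/eqP.
  by rewrite subr_eq0 => /eqP/injZ->.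
have lnV : ln (modulus (vandermonde Z)) =
    \sum_(j < n) \sum_(k < n | (j < k)%N) ln (modulus (Z j - Z k)).
  rewrite modulus_vandermonde ln_prod => [|j _].
    apply: eq_bigr => j _; apply: ln_prod => k jk; apply: dist_gt0.
    by apply: contraTneq jk => ->; rewrite ltnn.
  apply: prodr_gt0 => k jk; apply: dist_gt0.
  by apply: contraTneq jk => ->; rewrite ltnn.
rewrite /counting_potential /counting_mean -mulr_sumr mulrA.
have split_sum (F : 'I_n -> 'I_n -> R) : (forall j k, F j k = F k j) ->
    \sum_(j < n) \sum_(k < n) F j k =
    \sum_(j < n) F j j + 2 * \sum_(j < n) \sum_(k < n | (j < k)%N) F j k.
  move=> symF.
  have -> : \sum_(j < n) \sum_(k < n) F j k = \sum_(j < n) F j j +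
     \sum_(j < n) \sum_(k < n | (j < k)%N) F j k + \sum_(j < n) \sum_(k < n | (k < j)%N) F j k.
    rewrite -!big_split /=; apply: eq_bigr => j _.
    rewrite (bigD1 j)//= -addrA; congr (_ + _).
    rewrite (bigID (fun k : 'I_n => (j < k)%N)) /=; congr (_ + _); apply: eq_bigl => k.
      by rewrite andbC; case: ltnP => //= jk; apply/negP => /eqP kj; rewrite kj ltnn in jk.
    by rewrite -leqNgt ltn_neqAle.
  rewrite -addrA mulr2n mulrDl mul1r; congr (_ + (_ + _)).
  by rewrite (exchange_big_dep predT)//=; apply: eq_bigr => j _; apply: eq_bigr => k _.
rewrite split_sum; last by move=> j k; rewrite log_kernel_reg_subC.
under eq_bigr do rewrite subrr log_kernel_reg_diag//.
rewrite sumr_const card_ord.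
have h : \sum_(j < n) \sum_(k < n | (j < k)%N) log_kernel_reg e (Z j - Z k) <=
    - ln (modulus (vandermonde Z)).
  rewrite lnV -sumrN; apply: ler_sum => j _; rewrite -sumrN; apply: ler_sum => k jk.
  apply: log_kernel_reg_le => //; apply: dist_gt0.
  by apply: contraTneq jk => ->; rewrite ltnn.
have -> : - ln e / n%:R - 2 * ln (modulus (vandermonde Z)) / n%:R ^+ 2 =
    n%:R^-1 * n%:R^-1 * (- ln e *+ n + 2 * - ln (modulus (vandermonde Z))).
  by rewrite -[_ *+ n]mulr_natl; field; rewrite gt_eqF.
by rewrite ler_pM2l ?mulr_gt0 ?invr_gt0// lerD2l ler_pM2l.
Qed.

End counting.
End discrepancy.

(** * Quantitative estimates *)

Section estimates.
Context {R : realType}.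
Variables (E : set (plane R)) (mu : probability (borelC R) R) (V C s : R).
Hypotheses (compE : compact E) (muE : prob_on E mu).
Hypotheses (C1 : 1 <= C) (s0 : 0 < s).
Hypothesis reg_energy_le : forall e, 0 < e -> reg_energy mu e <= V.
Hypothesis holder : forall (z : R[i]) (u : R), Omega E (Some z) -> potential mu z = u%:E ->
  V - u <= C * dist_to E z `^ s.
Variables (M : R) (M1 : 1 <= M) (EM : forall z, E z -> modulus z <= M).
Implicit Types (z w t : R[i]).

Let E0 : E !=set0.
Proof.
have [z Ez _] := mean_exists_le compE muE (@continuous_plane_cst R 0).
by exists z.
Qed.

Let ln2_gt0 : 0 < ln 2 :> R. Proof. by rewrite ln_gt0// ltr1n. Qed.

Definition log_const : R := 1 + s^-1 + s^-1 * (ln C / ln 2).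
Definition energy_const : R := log_const + (4 + `|V|) / ln 2.
Definition gap_const : R := 2 * log_const + 2 + 2 * (ln (8 * M) / ln 2).
Definition diff_const : R := Num.sqrt ((energy_const + 2) * gap_const) + 2 / ln 2.

Lemma log_const_ge1 : 1 <= log_const.
Proof.
have : 0 <= s^-1 by rewrite invr_ge0 ltW.
have : 0 <= s^-1 * (ln C / ln 2).
  by rewrite mulr_ge0 ?invr_ge0 ?(ltW s0)// divr_ge0 ?(ltW ln2_gt0)// ln_ge0.
rewrite /log_const; lra.
Qed.

Lemma energy_const_ge1 : 1 <= energy_const.
Proof.
have : 0 <= (4 + `|V|) / ln 2 by rewrite divr_ge0 ?addr_ge0 ?(ltW ln2_gt0).
by rewrite /energy_const; have := log_const_ge1; lra.
Qed.

Lemma diff_const_gt0 : 0 < diff_const.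
Proof. by rewrite /diff_const ltr_wpDl ?sqrtr_ge0// divr_gt0. Qed.

Section fixed_size.
Variables (n : nat) (n2 : (2 <= n)%N).

Let N : R := n%:R.
Let l : R := ln N.

Let N2 : 2 <= N. Proof. by rewrite /N ler_nat. Qed.
Let N0 : 0 < N. Proof. by rewrite (lt_le_trans _ N2). Qed.
Let C0 : 0 < C. Proof. exact: lt_le_trans ltr01 C1. Qed.
Let CN1 : 1 <= C * N.
Proof. by rewrite -[leLHS]mulr1 ler_pM// (le_trans _ N2)// ler1n. Qed.
Let ln2_le : ln 2 <= l. Proof. by rewrite /l ler_ln ?posrE. Qed.

Definition holder_radius : R := (C * N) `^ (- s^-1).
Definition reg_param : R := holder_radius / N.

Lemma holder_radius_gt0 : 0 < holder_radius.
Proof. by rewrite powR_gt0// mulr_gt0. Qed.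

Lemma holder_radiusE : C * holder_radius `^ s = N^-1.
Proof.
rewrite /holder_radius -powRrM mulNr mulVf ?gt_eqF// powR_inv1; last exact: le_trans CN1.
by rewrite invfM mulrA mulfV ?mul1r// gt_eqF.
Qed.

Lemma reg_param_gt0 : 0 < reg_param.
Proof. by rewrite divr_gt0 ?holder_radius_gt0. Qed.

Lemma reg_param_le1 : reg_param <= 1.
Proof.
rewrite ler_pdivrMr// mul1r (@le_trans _ _ 1)//; last by rewrite (le_trans _ N2)// ler1n.
rewrite /holder_radius -[leRHS](powRr0 (C * N)); apply: ler_powR => //.
by rewrite oppr_le0 invr_ge0 ltW.
Qed.

Lemma ln_reg_param : - ln reg_param <= log_const * l.
Proof.
rewrite ln_div ?posrE ?holder_radius_gt0// ln_powR lnM ?posrE//.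
have h : ln C <= ln C / ln 2 * l.
  by rewrite -mulrA ler_peMr ?ln_ge0// mulrC ler_pdivlMr// mul1r.
have : s^-1 * ln C <= s^-1 * (ln C / ln 2 * l) by rewrite ler_wpM2l// invr_ge0 ltW.
rewrite /log_const -/l; lra.
Qed.

Let e := reg_param.
Let r := holder_radius.
Let e_gt0 : 0 < e. Proof. exact: reg_param_gt0. Qed.
Let e_le1 : e <= 1. Proof. exact: reg_param_le1. Qed.
Let r_gt0 : 0 < r. Proof. exact: holder_radius_gt0. Qed.

Let e_r : (e / r) ^+ 2 / 2 <= N^-1.
Proof.
have -> : e / r = N^-1 by rewrite /e /reg_param mulrAC mulfV ?mul1r// gt_eqF.
have i0 : 0 < N^-1 by rewrite invr_gt0.
have i1 : N^-1 <= 1 by rewrite invf_le1// (le_trans _ N2)// ler1n.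
have : N^-1 ^+ 2 <= N^-1 by rewrite expr2 ler_piMr// ltW.
lra.
Qed.

Lemma boundary_minimum f z : continuous f -> four_point_superharmonic e f -> E z ->
  exists b, [/\ Omega E (Some b), dist_to E b = r & f b <= f z].
Proof.
move=> cf sf Ez.
have Kz : filled_nbhd E r z by left => /OmegaN.
have [b [_ [Ob db] fb]] := @minimum_principle _ (filled_nbhd E r)
  [set b | Omega E (Some b) /\ dist_to E b = r] e f e_gt0
  (compact_filled_nbhd compE E0 r_gt0) cf sf (fun z => filled_nbhd_interior E0 r_gt0) z Kz.
by exists b.
Qed.

Lemma reg_potential_superharmonic : four_point_superharmonic e (reg_potential mu e).
Proof.
move=> z h he; have linM := mean_linear compE muE.
have ck w : continuous ((fun t => log_kernel_reg e (w - t)) : plane R -> R).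
  exact: continuous_log_kernel_reg.
have c2 := continuous_planeD (ck (z + h%:C%C)) (ck (z - h%:C%C)).
have c3 := continuous_planeD c2 (ck (z + (h *i)%C)).
have c4 := continuous_planeD c3 (ck (z - (h *i)%C)).
rewrite /reg_potential -(functionalZ linM 4 (ck z)).
rewrite -(functionalD linM (ck _) (ck _)) -(functionalD linM c2 (ck _)) -(functionalD linM c3 (ck _)).
apply: (mean_le compE muE) => //.
- by apply: continuous_planeM => //; exact: continuous_plane_cst.
- by move=> t _; exact: log_kernel_reg_superharmonic.
Qed.

Lemma reg_potential_boundary b : Omega E (Some b) -> dist_to E b = r ->
  V - 2 / N <= reg_potential mu e b.
Proof.
move=> Ob db; have dE t : E t -> r <= modulus (b - t) by move=> Et; rewrite -db dist_to_le.
have [u pu /(_ e e_gt0)] := potential_far compE muE r_gt0 dE.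
rewrite -/(reg_potential mu e b) => /andP[_ u2].
have := holder Ob pu; rewrite db holder_radiusE.
by have := e_r; lra.
Qed.

Lemma reg_potential_ge z : E z -> V - 2 / N <= reg_potential mu e z.
Proof.
move=> Ez; have cU := continuous_reg_potential compE muE e_gt0.
have [b [Ob db]] := boundary_minimum cU reg_potential_superharmonic Ez.
by apply: le_trans; exact: reg_potential_boundary.
Qed.

Section nodes.
Variables (Z : 'I_n -> R[i]) (FL : fekete_or_leja E Z).

Let n0 : (0 < n)%N. Proof. exact: ltnW n2. Qed.
Let ZE k : E (Z k). Proof. exact: fekete_or_leja_in FL. Qed.

Let bin2E : 'C(n, 2)%:R * 2 = N * (N - 1) :> R.
Proof.
have := bin_ffact n 2; rewrite !ffactnS ffactn0 muln1 => /(congr1 (fun k : nat => k%:R : R)).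
by rewrite !natrM -subn1 natrB// => ->.
Qed.

Lemma vandermonde_node_gt0 : 0 < modulus (vandermonde Z).
Proof.
have := exp_reg_energy_le compE muE (fun e he => reg_energy_le (proj1 (andP he)))
  (fun W EW => fekete_or_leja_vandermonde FL EW).
move=> /(lt_le_trans (expR_gt0 _)); rewrite pmulr_rgt0// ltr0n fact_gt0.
Qed.

Lemma ln_vandermonde_node_ge :
  - ((N - 1) * V / 2) - l <= ln (modulus (vandermonde Z)) / N.
Proof.
have V0 := vandermonde_node_gt0.
have := exp_reg_energy_le compE muE (fun e he => reg_energy_le (proj1 (andP he)))
  (fun W EW => fekete_or_leja_vandermonde FL EW).
have f0 : 0 < n`!%:R :> R by rewrite ltr0n fact_gt0.
move=> hB; have h : ln (expR (- ('C(n, 2)%:R * V))) <= ln (n`!%:R * modulus (vandermonde Z)).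
  by rewrite ler_ln ?posrE ?expR_gt0 ?mulr_gt0.
move: h; rewrite expRK lnM ?posrE// => h.
have fn : ln n`!%:R <= N * l.
  have : n`!%:R <= N ^+ n.
    rewrite -natrX ler_nat; elim: (n) => // m IH.
    rewrite factS expnS leq_mul// (leq_trans IH)//.
    by case: (posnP m) => [->//|m0]; rewrite leq_exp2r.
  move=> fN; have : ln n`!%:R <= ln (N ^+ n) by rewrite ler_ln ?posrE ?exprn_gt0.
  by rewrite lnXn// -[ln N *+ n]mulr_natl.
rewrite ler_pdivlMr//.
have -> : (- ((N - 1) * V / 2) - l) * N = - ('C(n, 2)%:R * V) - N * l.
  have -> : 'C(n, 2)%:R = N * (N - 1) / 2 :> R by rewrite -bin2E mulfK.
  by field.
lra.
Qed.

Lemma injective_node : injective Z.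
Proof.
apply: contrapT => /vandermonde_eq0 V0; have := vandermonde_node_gt0.
by rewrite V0 Normc.normc0 ltxx.
Qed.

Let e01 : 0 < e <= 1. Proof. by rewrite e_gt0 e_le1. Qed.

Lemma discrepancy_le_vandermonde : discrepancy mu Z e <=
  log_const * l / N - 2 * ln (modulus (vandermonde Z)) / N ^+ 2 - V + 4 / N.
Proof.
have h1 := counting_energy_le n0 e_gt0 injective_node.
have h2 : V - 2 / N <= counting_mean Z (reg_potential mu e).
  rewrite -[leLHS](counting_mean_cst Z n0); apply: counting_mean_le => // k.
  exact: reg_potential_ge.
have h3 := reg_energy_le e_gt0.
have h4 : - ln e / N <= log_const * l / N.
  by rewrite ler_pM2r ?invr_gt0//; exact: ln_reg_param.
rewrite /discrepancy; move: h1; rewrite -/N; lra.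
Qed.

Lemma const_le (a : R) : a <= `|a| / ln 2 * l.
Proof.
rewrite -mulrA; apply: le_trans (ler_norm _) _; rewrite ler_peMr// mulrC ler_pdivlMr// mul1r.
exact: ln2_le.
Qed.

Lemma discrepancy_le : discrepancy mu Z e <= (energy_const + 2) * l / N.
Proof.
apply: le_trans discrepancy_le_vandermonde _.
rewrite ler_pdivlMr//.
have := ln_vandermonde_node_ge; set W := ln _ => hW.
have -> : (log_const * l / N - 2 * W / N ^+ 2 - V + 4 / N) * N =
  log_const * l - 2 * (W / N) - V * N + 4 by field; rewrite gt_eqF.
have := const_le (- V); have := const_le 4; rewrite normrN ger0_norm//.
rewrite /energy_const; lra.
Qed.

Lemma ln_vandermonde_node_le :
  2 * ln (modulus (vandermonde Z)) / (N * (N - 1)) <= - V + 2 * energy_const * (l / N).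
Proof.
have := le_trans (discrepancy_ge0 compE muE n0 ZE e01) discrepancy_le_vandermonde.
set W := ln _ => h.
have N1 : 1 <= N - 1 by rewrite lerBrDr.
have N10 : 0 < N - 1 by exact: lt_le_trans N1.
have l0 : 0 < l by exact: lt_le_trans ln2_le.
have W1 : 2 * W / N <= log_const * l - V * N + 4.
  have : 0 <= (log_const * l / N - 2 * W / N ^+ 2 - V + 4 / N) * N by rewrite mulr_ge0// ltW.
  have -> : (log_const * l / N - 2 * W / N ^+ 2 - V + 4 / N) * N =
    log_const * l - 2 * W / N - V * N + 4 by field; rewrite gt_eqF.
  lra.
have W2 : 2 * W / N <= energy_const * l - V * (N - 1).
  have := const_le (- V); have := const_le 4; rewrite normrN ger0_norm//.
  rewrite /energy_const; lra.
have ec0 : 0 <= energy_const * l.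
  by rewrite mulr_ge0 ?(ltW l0)// (le_trans ler01 energy_const_ge1).
have -> : 2 * W / (N * (N - 1)) = (2 * W / N) / (N - 1) by field; rewrite !gt_eqF.
rewrite ler_pdivrMr//; apply: le_trans W2 _.
have : energy_const * l * 1 <= energy_const * l * (2 * (N - 1) / N).
  by rewrite ler_wpM2l// ler_pdivlMr// mul1r; lra.
move=> h1; rewrite -subr_ge0.
have -> : (- V + 2 * energy_const * (l / N)) * (N - 1) - (energy_const * l - V * (N - 1)) =
  energy_const * l * (2 * (N - 1) / N) - energy_const * l * 1.
  by field; rewrite gt_eqF.
by rewrite subr_ge0.
Qed.


Let sqrtN1 : 1 <= Num.sqrt N.
Proof. by rewrite -sqrtr1 ler_wsqrtr// (le_trans _ N2)// ler1n. Qed.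

Let sqrtN0 : 0 < Num.sqrt N. Proof. exact: lt_le_trans sqrtN1. Qed.

Let sqrtN2 : Num.sqrt N * Num.sqrt N = N.
Proof. by rewrite -expr2 sqr_sqrtr// ltW. Qed.

Let l_gt0 : 0 < l. Proof. exact: lt_le_trans ln2_le. Qed.

Let rate : R := l / Num.sqrt N.

Let rate_ge0 : 0 <= rate. Proof. by rewrite divr_ge0// ltW. Qed.

Let lN_rate : l / N <= rate.
Proof.
rewrite ler_pM2l// lef_pV2 ?posrE// -[leRHS]sqrtN2 ler_peMl//; exact: ltW.
Qed.

Let const_rate (a : R) : 0 <= a -> a / N <= a / ln 2 * rate.
Proof.
move=> a0; apply: (@le_trans _ _ (a / ln 2 * (l / N))).
  by rewrite mulrA ler_pM2r ?invr_gt0//; have := const_le a; rewrite ger0_norm.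
by rewrite ler_wpM2l// divr_ge0// ltW.
Qed.

Lemma potential_diff_far w : 2 * M <= modulus w ->
  `|counting_potential Z e w - reg_potential mu e w| <= 4 * M / modulus w.
Proof.
move=> Mw; have M0 : 0 < M by exact: lt_le_trans M1.
have w0 : 0 < modulus w by rewrite (lt_le_trans _ Mw)// mulr_gt0.
have near t : E t -> `|log_kernel_reg e (w - t) - log_kernel_reg e w| <= 2 * M / modulus w.
  move=> Et; have tM := EM Et.
  have wt : modulus w / 2 <= modulus (w - t).
    by have := le_modulus_dist w t; rewrite ler_norml => /andP[_]; lra.
  have wt0 : 0 < modulus (w - t) by rewrite (lt_le_trans _ wt)// divr_gt0.
  have a1 := log_kernel_reg_far w e_gt0 wt0.
  have a2 := log_kernel_reg_far (w - t) e_gt0 w0.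
  have b1 : modulus (w - t - w) / modulus (w - t) <= 2 * M / modulus w.
    have -> : w - t - w = - t by ring.
    rewrite normcN ler_pdivrMr// mulrAC ler_pdivlMr//.
    apply: (@le_trans _ _ (M * modulus w)); first by rewrite ler_wpM2r// ltW.
    by rewrite -mulrA mulrCA ler_wpM2l ?(ltW M0)//; lra.
  have b2 : modulus (w - (w - t)) / modulus w <= 2 * M / modulus w.
    have -> : w - (w - t) = t by ring.
    by rewrite ler_pM2r ?invr_gt0//; lra.
  by rewrite ler_norml; lra.
have ck : continuous ((fun t => log_kernel_reg e (w - t)) : plane R -> R).
  exact: continuous_log_kernel_reg.
have T := functional_dist (counting_mean_linear Z) (counting_mean_dominated n0 ZE)
  (counting_mean_cst Z n0 1) ck near.
have U := functional_dist (mean_linear compE muE) (mean_dominated compE muE) (mean1 mu) ck near.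
rewrite -/(counting_potential Z e w) in T; rewrite -/(reg_potential mu e w) in U.
by move: T U; rewrite !ler_norml => /andP[? ?] /andP[? ?]; lra.
Qed.

Lemma potential_diff z :
  `|counting_potential Z e z - reg_potential mu e z| <= diff_const * rate.
Proof.
have M0 : 0 < M by exact: lt_le_trans M1.
have M8 : 1 <= 8 * M by have := M1; lra.
have MN0 : 0 < 2 * M * N by rewrite !mulr_gt0.
have c2 : 2 / N <= 2 / ln 2 * rate by apply: const_rate.
have [zl|zs] := leP (2 * M * N) (modulus z).
  have z0 : 0 < modulus z by exact: lt_le_trans zl.
  have zM : 2 * M <= modulus z.
    by apply: le_trans zl; rewrite ler_peMr ?mulr_ge0 ?(ltW M0)// (le_trans _ N2)// ler1n.
  apply: le_trans (potential_diff_far zM) _.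
  apply: (@le_trans _ _ (2 / N)).
    rewrite ler_pdivrMr// mulrAC ler_pdivlMr//; lra.
  by apply: le_trans c2 _; rewrite ler_wpM2r// lerDr sqrtr_ge0.
pose w : R[i] := (2 * M * N)%:C%C.
have wE : modulus w = 2 * M * N by rewrite modulus_real gtr0_norm.
have farw : `|counting_potential Z e w - reg_potential mu e w| <= 2 / N.
  have := @potential_diff_far w; rewrite wE => h; apply: le_trans (h _) _.
    by rewrite ler_peMr ?mulr_ge0 ?(ltW M0)// (le_trans _ N2)// ler1n.
  by rewrite le_eqVlt; apply/orP; left; apply/eqP; field; rewrite !gt_eqF.
have gap : 2 * log_kernel_reg e 0 - 2 * log_kernel_reg e (z - w) <= gap_const * l.
  rewrite log_kernel_reg_diag//.
  have zw : modulus (z - w) <= 4 * M * N.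
    by apply: le_trans (modulus_dist _ 0 _) _; rewrite subr0 sub0r normcN wE; lra.
  have MN1 : 1 <= 4 * M * N.
    have : 1 <= M * N by rewrite -[leLHS]mulr1 ler_pM// (le_trans _ N2)// ler1n.
    lra.
  have : ln (modulus (z - w) ^+ 2 + e ^+ 2) <= ln ((8 * M * N) ^+ 2).
    have p8 : 0 < 8 * M * N by rewrite !mulr_gt0.
    rewrite ler_ln ?posrE ?(reg_arg_gt0 _ e_gt0) ?(exprn_gt0 _ p8)//.
    have h1 : modulus (z - w) ^+ 2 <= (4 * M * N) ^+ 2.
      by rewrite lerXn2r ?nnegrE ?modulus_ge0// (le_trans ler01).
    have h2 : e ^+ 2 <= 1 by rewrite expr_le1// ltW.
    have h3 : 1 <= (4 * M * N) ^+ 2 by rewrite exprn_ege1.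
    have -> : (8 * M * N) ^+ 2 = 4 * (4 * M * N) ^+ 2 by ring.
    lra.
  rewrite lnXn ?mulr_gt0// lnM ?posrE ?mulr_gt0// -/l -[_ *+ 2]mulr_natl => h.
  have := const_le (ln (8 * M)).
  rewrite ger0_norm ?ln_ge0//.
  have := ln_reg_param; rewrite -/e => h1 h2.
  rewrite /log_kernel_reg /gap_const; lra.
have form x := discrepancy_form compE muE n0 ZE x z w e01.
set b := counting_potential Z e z - _ - _ in form.
set G := 2 * _ - _ in gap form.
have g0 : 0 < gap_const.
  have : 0 <= ln (8 * M) / ln 2 by rewrite divr_ge0 ?(ltW ln2_gt0)// ln_ge0.
  by rewrite /gap_const; have := log_const_ge1; lra.
have g1 : 0 < gap_const * l by rewrite mulr_gt0.
have k0 : 0 <= energy_const + 2 by have := energy_const_ge1; lra.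
have bb : b ^+ 2 <= (energy_const + 2) * gap_const * rate ^+ 2.
  have := form (- b / (gap_const * l)).
  have h1 : (- b / (gap_const * l)) ^+ 2 * G <= (- b / (gap_const * l)) ^+ 2 * (gap_const * l).
    by rewrite ler_wpM2l ?sqr_ge0.
  have h2 : (- b / (gap_const * l)) ^+ 2 * (gap_const * l) = b ^+ 2 / (gap_const * l).
    by field; rewrite !gt_eqF.
  have h3 : 2 * (- b / (gap_const * l)) * b = - 2 * (b ^+ 2 / (gap_const * l)).
    by field; rewrite !gt_eqF.
  rewrite h3 => h4.
  have : b ^+ 2 / (gap_const * l) <= (energy_const + 2) * l / N by have := discrepancy_le; lra.
  rewrite ler_pdivrMr// => /le_trans; apply.
  rewrite /rate exprMn exprVn expr2 (expr2 (Num.sqrt N)) sqrtN2.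
  by rewrite le_eqVlt; apply/orP; left; apply/eqP; field; rewrite gt_eqF.
have babs : `|b| <= Num.sqrt ((energy_const + 2) * gap_const) * rate.
  rewrite -sqrtr_sqr; apply: le_trans (ler_wsqrtr bb) _.
  by rewrite sqrtrM ?mulr_ge0 ?(ltW g0)// sqrtr_sqr ger0_norm.
have -> : counting_potential Z e z - reg_potential mu e z =
    b + (counting_potential Z e w - reg_potential mu e w) by rewrite /b; ring.
apply: le_trans (ler_normD _ _) _; rewrite /diff_const mulrDl; apply: lerD => //.
exact: le_trans farw c2.
Qed.

Lemma node_deviation w : robin E = V%:E -> (forall t, E t -> r <= modulus (w - t)) ->
  (`|deviation E mu n (node_poly Z) (Some w)| <= ((diff_const + 2 / ln 2) * rate)%:E)%E.
Proof.
move=> rV wE.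
have w0 k : 0 < modulus (w - Z k) by exact: lt_le_trans (wE _ (ZE k)).
have [u pu /(_ e e_gt0)] := potential_far compE muE r_gt0 wE.
rewrite -/(reg_potential mu e w) => u12.
have PE : modulus (node_poly Z).[w] = \prod_(k < n) modulus (w - Z k) :> R.
  by rewrite /node_poly horner_prod modulus_prod; apply: eq_bigr => k _; rewrite !hornerE.
have P0 : 0 < modulus (node_poly Z).[w] by rewrite PE prodr_gt0.
pose q := counting_mean Z (fun t => - ln (modulus (w - t))).
have qE : N^-1 * ln (modulus (node_poly Z).[w]) = - q.
  by rewrite PE ln_prod// /q /counting_mean sumrN mulrN opprK.
have q1 : counting_potential Z e w <= q.
  by apply: counting_mean_le => // k; exact: log_kernel_reg_le.
have q2 : q <= counting_potential Z e w + N^-1.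
  rewrite -[N^-1](counting_mean_cst Z n0).
  have -> : counting_potential Z e w + counting_mean Z (fun=> N^-1) =
     counting_mean Z (fun t => log_kernel_reg e (w - t) + N^-1).
    by rewrite /counting_potential /counting_mean big_split mulrDr.
  apply: counting_mean_le => // k; apply: le_trans (log_kernel_reg_ge e_gt0 r_gt0 (wE _ (ZE k))) _.
  by rewrite lerD2l e_r.
rewrite /deviation /green rV pu lne_EFin// -EFinB abse_EFin lee_fin.
rewrite -/N qE; have := potential_diff w; have := e_r.
have : 1 / N <= 1 / ln 2 * rate by apply: const_rate.
move=> c1 er.
have -> : (diff_const + 2 / ln 2) * rate = diff_const * rate + 2 * (1 / ln 2 * rate) by ring.
move: c1; rewrite -[1 / N]/(1 * N^-1) mul1r => c1.
case/andP: u12 => u1 u2; rewrite !ler_norml => /andP[d1 d2].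
by apply/andP; split; lra.
Qed.

Lemma node_poly_le z : E z ->
  modulus (node_poly Z).[z] <= expR (- (N * V) + 2 + diff_const * (Num.sqrt N * l)).
Proof.
move=> Ez.
have PE : modulus (node_poly Z).[z] = \prod_(k < n) modulus (z - Z k) :> R.
  by rewrite /node_poly horner_prod modulus_prod; apply: eq_bigr => k _; rewrite !hornerE.
have := modulus_ge0 (node_poly Z).[z]; rewrite le_eqVlt => /predU1P[<-|P0].
  exact: expR_ge0.
have w0 k : 0 < modulus (z - Z k).
  rewrite lt0r modulus_ge0 andbT; apply: contraTneq P0 => zk.
  by rewrite PE (bigD1 k)//= zk mul0r ltxx.
have sf : four_point_superharmonic e (counting_potential Z e).
  exact: counting_potential_superharmonic.
have cf := continuous_counting_potential (Z := Z) n0 e_gt0.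
have [b [Ob db fb]] := boundary_minimum cf sf Ez.
have := potential_diff b; rewrite ler_norml => /andP[d1 _].
have := reg_potential_boundary Ob db => h.
rewrite -[leLHS]lnK ?posrE// ler_expR PE ln_prod//.
have le1 : \sum_(k < n) ln (modulus (z - Z k)) <= - (N * counting_potential Z e z).
  rewrite /counting_potential /counting_mean mulrA mulfV ?gt_eqF// mul1r -sumrN.
  by apply: ler_sum => k _; rewrite lerNr log_kernel_reg_le.
apply: le_trans le1 _.
have : N * (V - 2 / N - diff_const * rate) <= N * counting_potential Z e z.
  by rewrite ler_wpM2l ?(ltW N0)//; lra.
have -> : N * (V - 2 / N - diff_const * rate) =
    N * V - 2 - diff_const * (Num.sqrt N * l).
  have <- : N * rate = Num.sqrt N * l.
    by rewrite /rate -{1}sqrtN2; field; rewrite gt_eqF.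
  by field; rewrite gt_eqF.
lra.
Qed.

Lemma node_sup_norm : robin E = V%:E ->
  (lne (sup_norm E (node_poly Z)) + n%:R%:E * robin E
    <= ((diff_const + 2 / ln 2) * (Num.sqrt N * l) + 1)%:E)%E.
Proof.
move=> rV.
have le1 : (sup_norm E (node_poly Z) <=
    (expR (- (N * V) + 2 + diff_const * (Num.sqrt N * l)))%:E)%E.
  by apply: ge_ereal_sup => _ [z Ez <-]; rewrite lee_fin node_poly_le.
have ge0 : (0 <= sup_norm E (node_poly Z))%E.
  have [z Ez] := E0; apply: le_trans (ereal_sup_ubound _); last by exists z.
  by rewrite lee_fin modulus_ge0.
have : (lne (sup_norm E (node_poly Z)) <=
    (- (N * V) + 2 + diff_const * (Num.sqrt N * l))%:E)%E.
  rewrite -[leRHS]expeRK lee_lne//= in_itv /= ?leey ?ge0//.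
  by rewrite lee_fin expR_ge0.
rewrite rV -EFinM -/N => h; apply: le_trans (leeD2r _ h) _.
rewrite -EFinD lee_fin.
have s1 : 1 <= 1 / ln 2 * (Num.sqrt N * l).
  have : 1 <= 1 / ln 2 * l by have := const_le 1; rewrite normr1.
  move=> /le_trans; apply; rewrite mulrCA ler_peMl// mulr_ge0 ?(ltW l_gt0)// divr_ge0// ltW//.
have -> : (diff_const + 2 / ln 2) * (Num.sqrt N * l) =
  diff_const * (Num.sqrt N * l) + 2 * (1 / ln 2 * (Num.sqrt N * l)) by ring.
lra.
Qed.

Lemma node_discrete_energy : robin E = V%:E ->
  ((- (2 * energy_const * rate))%:E <= discrete_energy Z - robin E)%E.
Proof.
move=> rV; have V0 := vandermonde_node_gt0.
rewrite /discrete_energy rV lne_EFin ?powR_gt0// ln_powR -EFinN -EFinB lee_fin -/N.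
have h := ln_vandermonde_node_le.
have h2 : 2 * energy_const * (l / N) <= 2 * energy_const * rate.
  apply: ler_wpM2l lN_rate; apply: mulr_ge0 => //.
  exact: le_trans ler01 energy_const_ge1.
have -> : 2 / (N * (N - 1)) * ln (modulus (vandermonde Z)) =
   2 * ln (modulus (vandermonde Z)) / (N * (N - 1)) by rewrite mulrAC.
lra.
Qed.

End nodes.
End fixed_size.
End estimates.

(** * Conclusion *)

Lemma finite_robin (R : realType) (E : set (plane R)) (mu : probability (borelC R) R) :
  compact E -> (0 < capacity E)%E -> is_equilibrium_measure E mu ->
  exists V : R, robin E = V%:E /\ forall e, 0 < e -> reg_energy mu e <= V.
Proof.
move=> compE cap0 [muE en].
have reg_le (e : R) : 0 < e -> ((reg_energy mu e)%:E <= robin E)%E.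
  by move=> e0; rewrite -en; exact: (energy_ge_reg compE muE).
move: cap0 reg_le; rewrite /capacity; case: (robin E) => [V _ reg_le||_ /(_ 1 ltr01)//].
  by exists V; split => // e /reg_le; rewrite lee_fin.
by rewrite /= ltxx.
Qed.

Lemma closure_Omega_n_far (R : realType) (E : set (plane R)) (mu : probability (borelC R) R)
    (C s : R) (n : nat) (w : R[i]) : 1 <= C -> 0 < s -> (2 <= n)%N ->
  (forall z, Omega E (Some z) -> (green E mu z <= (C * dist_to E z `^ s)%:E)%E) ->
  closure (Omega_n E mu n) (Some w) ->
  forall t, E t -> holder_radius C s n <= modulus (w - t).
Proof.
move=> C1 s0 n2 hol clw t Et; set r := holder_radius C s n.
have C0 : 0 < C by exact: lt_le_trans C1.
have r0 : 0 <= r by exact: powR_ge0.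
have rE : C * r `^ s = n%:R^-1 by exact: holder_radiusE.
have far z : Omega_n E mu n (Some z) -> r <= dist_to E z.
  move=> [Oz /= gz]; have := lt_le_trans gz (hol z Oz); rewrite lte_fin -rE.
  rewrite ltr_pM2l// => lt; rewrite leNgt; apply/negP => /ltW dr.
  move: lt; apply/negP; rewrite -leNgt; apply: ge0_ler_powR; rewrite ?nnegrE ?(ltW s0)//.
  have E0 : E !=set0 by exists t.
  by apply: (dist_to_ge E0) => ? _; exact: modulus_ge0.
apply/ler_addgt0Pr => d d0.
have nb : nbhs (Some w : sphere R) (Some @` [set z : plane R | modulus (w - z) < d]).
  by apply: one_point_compactification_some_nbhs; apply/nbhs_planeP; exists d.
have [p [Op [v wv vp]]] := clw _ nb.
have rv : r <= dist_to E v by apply: far; rewrite vp.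
apply: le_trans rv _; apply: le_trans (dist_to_le v Et) _.
by apply: le_trans (modulus_dist v w t) _; rewrite addrC lerD2l modulus_subC ltW.
Qed.

Theorem corollary2p3 (R : realType) (E : set (plane R))
    (muE : probability (borelC R) R) :
  compact E ->
  (0 < capacity E)%E ->
  is_equilibrium_measure E muE ->
  green_holder E muE ->
  exists C2 C3 : R, 0 < C2 /\ 0 < C3 /\
    forall (n : nat) (Z : 'I_n -> R[i]), (2 <= n)%N -> fekete_or_leja E Z ->
      [/\ forall z, closure (Omega_n E muE n) z ->
            (`|deviation E muE n (node_poly Z) z|
              <= (C2 * (ln n%:R / Num.sqrt n%:R))%:E)%E,
          (lne (sup_norm E (node_poly Z)) + n%:R%:E * robin E
            <= (C2 * (Num.sqrt n%:R * ln n%:R) + 1)%:E)%E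
        & ((- (C3 * (ln n%:R / Num.sqrt n%:R)))%:E
            <= discrete_energy Z - robin E)%E].
Proof.
move=> compE cap0 eqE [C0 [s [C00 /andP[s0 s1] hol]]].
have [V [rV regV]] := finite_robin compE cap0 eqE.
have [pE _] := eqE.
pose C := Num.max C0 1.
have C1 : 1 <= C by rewrite le_max lexx orbT.
have holC z : Omega E (Some z) -> (green E muE z <= (C * dist_to E z `^ s)%:E)%E.
  move=> /hol /le_trans; apply; rewrite lee_fin ler_wpM2r ?powR_ge0//.
  by rewrite le_max lexx.
have holder z u : Omega E (Some z) -> potential muE z = u%:E -> V - u <= C * dist_to E z `^ s.
  by move=> /holC + pu; rewrite /green rV pu -EFinB lee_fin.
have [M0 _ EM0] := compact_plane_bounded compE.
pose M := Num.max M0 1.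
have M1 : 1 <= M by rewrite le_max lexx orbT.
have EM z : E z -> modulus z <= M by move=> /EM0 /le_trans; apply; rewrite le_max lexx.
exists (diff_const V C s M + 2 / ln 2), (2 * energy_const V C s).
have ln2 : 0 < ln 2 :> R by rewrite ln_gt0// ltr1n.
split; first by rewrite addr_gt0 ?divr_gt0 ?diff_const_gt0.
split; first by rewrite mulr_gt0// (lt_le_trans ltr01 (energy_const_ge1 _ C1 s0)).
move=> n Z n2 FL; split; first 1 last.
- exact: node_sup_norm compE pE C1 s0 regV holder _ M1 EM _ n2 _ FL rV.
- exact: node_discrete_energy compE pE C1 s0 regV holder _ n2 _ FL rV.
move=> [w|] clw.
  apply: (node_deviation compE pE C1 s0 regV holder M1 EM n2 FL rV).
  exact: closure_Omega_n_far C1 s0 n2 holC clw.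
rewrite /deviation abse0 lee_fin mulr_ge0// ?divr_ge0 ?sqrtr_ge0 ?ln_ge0//.
  by rewrite ltW// addr_gt0 ?divr_gt0 ?diff_const_gt0.
by rewrite ler1n ltnW.
Qed.
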